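(* Let $\mathbb{G}$ be a finite quantum group and let $\nu\in M_p(\mathbb{G})$ be a state whose density $f_\nu$ lies in the central algebra $F(\mathbb{G})_0$, say $f_\nu=\sum_{\alpha\in\operatorname{Irr}(\mathbb{G})}f_\alpha\chi_\alpha$ with $f_\alpha\in\mathbb{C}$. Then the random walk on $\mathbb{G}$ given by $\nu$ is ergodic if and only if $|f_\alpha|<d_\alpha$ for all non-trivial irreducible representations $\kappa_\alpha$, $\alpha\in\operatorname{Irr}(\mathbb{G})$.
   Context: A finite quantum group $\mathbb{G}$ is given by its algebra of functions $F(\mathbb{G})$: a finite-dimensional unital $\mathrm{C}^*$-algebra with a $*$-homomorphism (comultiplication) $\Delta:F(\mathbb{G})\to F(\mathbb{G})\otimes F(\mathbb{G})$, a counit $\varepsilon$ and an antipode $S$ making $(F(\mathbb{G}),\Delta,S,\varepsilon)$ a Hopf $*$-algebra. $M_p(\mathbb{G})$ denotes the set of states on $F(\mathbb{G})$ (positive linear functionals taking the value $1$ at the unit). A random walk on $\mathbb{G}$ is given by a state $\nu\in M_p(\mathbb{G})$; its convolution powers are $\nu^{\star 1}=\nu$, $\nu^{\star(k+1)}=(\nu\otimes\nu^{\star k})\circ\Delta$. The convolution of states is $\mu\star\nu:=(\mu\otimes\nu)\Delta$. The Haar state $\int_{\mathbb{G}}$ is the unique state $\pi$ with $\pi\star\mu=\pi=\mu\star\pi$ for all $\mu\in M_p(\mathbb{G})$; it is faithful and tracial. The random walk given by $\nu$ is ergodic if $(\nu^{\star k})_{k\ge1}$ converges to the Haar state. The density of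 $\nu$ is the unique element $f_\nu\in F(\mathbb{G})$ with $\nu(g)=\int_{\mathbb{G}}f_\nu g$ for all $g\in F(\mathbb{G})$. $\operatorname{Irr}(\mathbb{G})$ is an index set for a complete family of pairwise inequivalent irreducible unitary representations of $\mathbb{G}$, given by corepresentations $\kappa_\alpha:V_\alpha\to V_\alpha\otimes F(\mathbb{G})$, with $d_\alpha=\dim V_\alpha$ and matrix coefficients $\rho^\alpha_{ij}\in F(\mathbb{G})$, $1\le i,j\le d_\alpha$ (with respect to an orthonormal basis of $V_\alpha$). The trivial representation is the one-dimensional one with matrix coefficient the unit of $F(\mathbb{G})$. The character of $\kappa_\alpha$ is $\chi_\alpha:=\sum_{i=1}^{d_\alpha}\rho^\alpha_{ii}\in F(\mathbb{G})$, and the central algebra is $F(\mathbb{G})_0:=\operatorname{span}\{\chi_\alpha:\alpha\in\operatorname{Irr}(\mathbb{G})\}$. *)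

(* Defs.v *)
From HB Require Import structures.
From mathcomp Require Import all_boot all_order all_algebra sesquilinear.
From mathcomp Require Import falgebra complex.
From mathcomp Require Import all_classical reals topology normedtype sequences.

Set Implicit Arguments.
Unset Strict Implicit.
Unset Printing Implicit Defensive.

Import Order.TTheory GRing.Theory Num.Theory Num.Def.
Import numFieldNormedType.Exports.
Local Open Scope classical_set_scope.
Local Open Scope ring_scope.
Local Open Scope complex_scope.

(* The tensor product of two finite-dimensional spaces, as coordinate         *)
(* matrices with respect to the tensors of the library's bases of U and V;    *)
(* tlift_pure below is its universal property.                                *)
Notation tensor U V := 'M_(\dim {:U}, \dim {:V}).

Section Tensor.
Variable K : fieldType.

Definition pure (U V : vectType K) (u : U) (v : V) : tensor U V :=
  \matrix_(i, j) (coord (vbasis {:U}) i u * coord (vbasis {:V}) j v).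

(* The linear map on the tensor product induced by a bilinear map beta.       *)
Definition tlift (U V : vectType K) (W : lmodType K) (beta : U -> V -> W)
    (t : tensor U V) : W :=
  \sum_i \sum_j t i j *: beta (vbasis {:U})`_i (vbasis {:V})`_j.

Definition tmap (U V U' V' : vectType K) (f : U -> U') (g : V -> V') :
    tensor U V -> tensor U' V' :=
  tlift (fun u v => pure (f u) (g v)).

Definition tassoc (U V W : vectType K) :
    tensor (tensor U V) W -> tensor U (tensor V W) :=
  tlift (fun t w => tlift (fun u v => pure u (pure v w)) t).

Definition tmul (A : falgType K) (s t : tensor A A) : tensor A A :=
  tlift (fun a b => tlift (fun c d => pure (a * c) (b * d)) t) s.

Definition tsub (U V : vectType K) (U1 : {vspace U}) : {vspace tensor U V} :=
  <<[seq pure u v | u <- vbasis U1, v <- vbasis {:V}]>>%VS.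

Lemma pure_bilinear (U V : vectType K) :
  bilinear_for *:%R *:%R (@pure U V).
Proof.
split=> [v|u] a x y; apply/matrixP=> i j; rewrite !mxE linearP /=.
  by rewrite mulrDl mulrA.
by rewrite mulrDr mulrCA.
Qed.

Lemma tlift_is_linear (U V : vectType K) (W : lmodType K) (beta : U -> V -> W) :
  linear (tlift beta).
Proof.
move=> a s t; rewrite /tlift scaler_sumr -big_split; apply: eq_bigr => i _ /=.
rewrite scaler_sumr -big_split; apply: eq_bigr => j _ /=.
by rewrite !mxE scalerDl scalerA.
Qed.

Lemma tlift_pure (U V : vectType K) (W : lmodType K) (beta : U -> V -> W) u v :
  bilinear_for *:%R *:%R beta -> tlift beta (pure u v) = beta u v.
Proof.
move=> [bl br].
pose L w : {linear U -> W} := HB.pack_for {linear U -> W} (beta ^~ w)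
  (GRing.isLinear.Build K U W *:%R (beta ^~ w) (bl w)).
pose M w : {linear V -> W} := HB.pack_for {linear V -> W} (beta w)
  (GRing.isLinear.Build K V W *:%R (beta w) (br w)).
rewrite -[RHS]/(L v u) [in RHS](coord_vbasis (memvf u)) linear_sum.
apply: eq_bigr => i _; rewrite linearZ_LR -[L v _]/(M (vbasis {:U})`_i v).
rewrite [in RHS](coord_vbasis (memvf v)) linear_sum scaler_sumr.
by apply: eq_bigr => j _; rewrite linearZ_LR mxE scalerA.
Qed.

Lemma tmul_pure (A : falgType K) (a b c d : A) :
  tmul (pure a b) (pure c d) = pure (a * c) (b * d).
Proof.
have pl := (pure_bilinear A A).1; have pr := (pure_bilinear A A).2.
have in_pure a' b' :
  tlift (fun c d => pure (a' * c) (b' * d)) (pure c d) = pure (a' * c) (b' * d).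
  apply: tlift_pure; split=> [v|u] k x y; rewrite mulrDr -scalerAr.
    by rewrite pl.
  by rewrite pr.
rewrite /tmul tlift_pure ?in_pure //.
by split=> [v|u] k x y; rewrite /= !in_pure mulrDl -scalerAl ?pl ?pr.
Qed.

End Tensor.

Section QuantumGroup.
Variable R : realType.
Local Notation C := R[i].

(* Completeness of the norm is automatic in finite dimension.                 *)
Record cstar_algebra := CstarAlgebra {
  cstar_carrier :> falgType C;
  star : cstar_carrier -> cstar_carrier;
  cstar_norm : cstar_carrier -> R;
  star_involutive : involutive star;
  star_conj_linear : forall (c : C) a b,
    star (c *: a + b) = conjC c *: star a + star b;
  star_anti_mul : forall a b, star (a * b) = star b * star a;
  cstar_norm_eq0 : forall a, cstar_norm a = 0 -> a = 0;
  cstar_norm_triangle : forall a b,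
    cstar_norm (a + b) <= cstar_norm a + cstar_norm b;
  cstar_normZ : forall (c : C) a,
    (cstar_norm (c *: a))%:C = `|c| * (cstar_norm a)%:C;
  cstar_norm_mul : forall a b, cstar_norm (a * b) <= cstar_norm a * cstar_norm b;
  cstar_identity : forall a, cstar_norm (star a * a) = cstar_norm a ^+ 2
}.

(* The conjugate-linear extension of star a (x) star b.                       *)
Definition tstar (A : cstar_algebra) (t : tensor A A) : tensor A A :=
  tlift (fun a b => pure (star a) (star b)) (map_mx conjC t).

Lemma tstar_pure (A : cstar_algebra) (a b : A) :
  tstar (pure a b) = pure (star a) (star b).
Proof.
have pl := (pure_bilinear A A).1; have pr := (pure_bilinear A A).2.
pose beta (x y : A) := pure (star x) (star y).
pose cbeta (x y : A) := map_mx conjC (beta x y).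
have cE x y : beta x y = map_mx conjC (cbeta x y).
  by apply/matrixP=> i j; rewrite !mxE conjCK.
rewrite -[RHS]/(beta a b) cE -(@tlift_pure _ A A _ cbeta); last first.
  split=> [v|u] k x y; apply/matrixP=> i j;
    rewrite /cbeta /beta star_conj_linear ?pl ?pr !mxE rmorphD rmorphM /=;
    by rewrite conjCK.
rewrite /tstar /tlift; apply/matrixP=> p q.
rewrite mxE !summxE rmorph_sum; apply: eq_bigr => i _ /=.
rewrite !summxE rmorph_sum; apply: eq_bigr => j _ /=.
by rewrite !mxE !rmorphM /= !conjCK.
Qed.

Record finite_quantum_group := FiniteQuantumGroup {
  functions :> cstar_algebra;
  comult : {linear functions -> tensor functions functions};
  counit : {lrmorphism functions -> C | *%R};
  antipode : {linear functions -> functions};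
  comult1 : comult 1 = pure 1 1;
  comultM : forall a b, comult (a * b) = tmul (comult a) (comult b);
  comult_star : forall a, comult (star a) = tstar (comult a);
  comultA : forall a,
    tassoc (tmap comult id (comult a)) = tmap id comult (comult a);
  counit_left : forall a, tlift (fun b c => counit b *: c) (comult a) = a;
  counit_right : forall a, tlift (fun b c => counit c *: b) (comult a) = a;
  antipode_left : forall a,
    tlift (fun b c => antipode b * c) (comult a) = counit a *: 1;
  antipode_right : forall a,
    tlift (fun b c => b * antipode c) (comult a) = counit a *: 1
}.

Variable G : finite_quantum_group.

Definition is_state (mu : {scalar G}) : Prop :=
  mu 1 = 1 /\ forall a, 0 <= mu (star a * a).

Definition conv_fun (mu nu : G -> C) (a : G) : C :=
  tlift (fun b c => (mu b * nu c : C^o)) (comult G a).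

Lemma conv_fun_is_scalar mu nu : scalar (conv_fun mu nu).
Proof. by move=> c a b; rewrite /conv_fun linearP tlift_is_linear. Qed.

Definition conv (mu nu : {scalar G}) : {scalar G} :=
  HB.pack_for {scalar G} (conv_fun mu nu)
    (GRing.isLinear.Build C G C *%R (conv_fun mu nu)
       (conv_fun_is_scalar mu nu)).

(* conv_pow nu 1 = nu and conv_pow nu k.+1 = conv nu (conv_pow nu k) for      *)
(* k >= 1; the value at k = 0 is junk.                                        *)
Definition conv_pow (nu : {scalar G}) (k : nat) : {scalar G} :=
  iter k.-1 (conv nu) nu.

Definition is_haar (h : {scalar G}) : Prop :=
  is_state h /\
  forall mu, is_state mu -> conv h mu =1 h /\ conv mu h =1 h.

(* F(G) being finite dimensional, every vector space topology on its dual is  *)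
(* that of pointwise convergence.                                             *)
Definition ergodic (h nu : {scalar G}) : Prop :=
  forall a, (fun k => conv_pow nu k a : (C : numFieldType)) @ \oo
              --> (h a : (C : numFieldType)).

Definition is_density (h nu : {scalar G}) (f : G) : Prop :=
  forall g, nu g = h (f * g).

(* kappa(e_j) = \sum_i e_i (x) rho_ij                                         *)
Definition matrix_coef (V : vectType C) (ip : {dot V for conjC})
    (e : (\dim {:V}).-tuple V) (kappa : V -> tensor V G)
    (i j : 'I_(\dim {:V})) : G :=
  tlift (fun v a => ip v (tnth e i) *: a) (kappa (tnth e j)).

Record unitary_rep := UnitaryRep {
  rep_space :> vectType C;
  rep_ip : {dot rep_space for conjC};
  rep_basis : (\dim {:rep_space}).-tuple rep_space;
  coaction : {linear rep_space -> tensor rep_space G};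
  rep_basis_orthonormal : orthonormal rep_ip rep_basis;
  coactionA : forall v,
    tassoc (tmap coaction id (coaction v)) = tmap id (comult G) (coaction v);
  coaction_counit : forall v,
    tlift (fun w a => counit G a *: w) (coaction v) = v;
  rho := matrix_coef rep_ip rep_basis coaction;
  rep_unitary_left : forall i j,
    \sum_k star (rho k i) * rho k j = (i == j)%:R;
  rep_unitary_right : forall i j,
    \sum_k rho i k * star (rho j k) = (i == j)%:R
}.

Definition rep_dim (V : unitary_rep) : nat := \dim {:V}.

Definition invariant (V : unitary_rep) (U : {vspace V}) : Prop :=
  forall u, u \in U -> coaction V u \in tsub G U.

Definition irreducible_rep (V : unitary_rep) : Prop :=
  (0 < rep_dim V)%N /\
  forall U : {vspace V}, invariant U -> U = 0%VS \/ U = fullv.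

Definition equivalent (V W : unitary_rep) : Prop :=
  exists T : {linear V -> W}, bijective T /\
    forall v, coaction W (T v) = tmap T id (coaction V v).

Definition trivial_rep (V : unitary_rep) : Prop :=
  rep_dim V = 1%N /\ forall i j, @rho V i j = 1.

Definition character (V : unitary_rep) : G := \sum_i @rho V i i.

Definition complete_irr (Irr : Type) (kappa : Irr -> unitary_rep) : Prop :=
  [/\ forall alpha, irreducible_rep (kappa alpha),
      forall alpha beta, equivalent (kappa alpha) (kappa beta) -> alpha = beta
    & forall V, irreducible_rep V -> exists alpha, equivalent V (kappa alpha)].

Definition central_algebra (Irr : finType) (kappa : Irr -> unitary_rep) :
    {vspace G} :=
  <<[seq character (kappa alpha) | alpha : Irr]>>%VS.

End QuantumGroup.

(* Main.v *)
From HB Require Import structures.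
From mathcomp Require Import all_boot all_order all_algebra sesquilinear.
From mathcomp Require Import falgebra complex spectral.
From mathcomp Require Import all_classical reals topology normedtype sequences.
From mathcomp Require Import ring lra.
Require Import Defs.

Set Implicit Arguments.
Unset Strict Implicit.
Unset Printing Implicit Defensive.

Import Order.TTheory GRing.Theory Num.Theory Num.Def.
Import numFieldNormedType.Exports.
Local Open Scope ring_scope.
Local Open Scope complex_scope.

(** Write u^alpha for the matrix of coefficients of the irreducible
    representation alpha, of dimension d_alpha, and h for the Haar state.

    A density in the span of the characters makes nu act as a scalar on every
    block of coefficients.  The orthogonality relations
      h (star u^alpha_ip * u^beta_jq) = [alpha = beta, i = j, p = q] / d_alpha
    and the trace property of h give
      nu (star u^alpha_ij) = [i = j] f_alpha / d_alpha
    (central_state_rho).  Since Delta (star u_ij) is the sum over m of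
    star u_im (x) star u_mj, the k-th convolution power takes the value
    [i = j] (f_alpha / d_alpha)^k there (conv_pow_rho).  The Haar state
    vanishes on the coefficients of every nontrivial irreducible
    representation (ntrace_rho_nontrivial), whereas on the trivial one both
    sequences are constantly 1.  The adjoints of the coefficients span F(G)
    (peter_weyl), so the powers of nu converge to h exactly when
    (f_alpha / d_alpha)^k tends to 0 for every nontrivial alpha, that is, when
    |f_alpha| < d_alpha.

    What has to be built is the Haar state as a faithful, tracial, invariant
    functional.  It is obtained as the normalised trace t of the left regular
    representation of the algebra F(G), which is tracial by construction.
    - t is positive and faithful (reg_trace_ge0): the C*-identity forces a
      selfadjoint x to have real spectrum, so the trace of x^2 is a sum of
      squares; the trace property reduces star a * a to two such squares.
    - t is idempotent for convolution (reg_trace_conv): the map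
      x (x) y |-> Delta(x) (1 (x) y) is invertible because of the antipode and
      intertwines multiplication by a (x) 1 with multiplication by Delta(a), so
      that both have equal traces.
    - t is invariant (ntrace_left_invariant): if b = (t (x) id) Delta(a), then
      (t (x) id) Delta(b) = b, and this is the equality case of the
      Cauchy-Schwarz inequality, which by faithfulness means
      Delta(b) = 1 (x) b; hence b is a scalar.
    The convolution of t with h is h by the defining property of the Haar state
    and t by the invariance of t, so h = t (haar_ntrace).

    With h in hand, Schur's lemma and the averages h (star u_im * u_jn) give
    the orthogonality relations.  For the Peter-Weyl theorem, the orthogonal
    complement of the span of all coefficients is a subcomodule of F(G); a
    minimal nonzero subcomodule of it would carry an irreducible unitary
    representation, whose own coefficients contain it. *)

(** * Maps out of tensor products *)

Section TensorCalculus.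
Variable K : fieldType.
Implicit Types U V X Y Z : vectType K.
Implicit Types W : lmodType K.

HB.instance Definition _ U V W (beta : U -> V -> W) :=
  GRing.isLinear.Build K (tensor U V) W *:%R (tlift beta)
    (tlift_is_linear beta).

HB.instance Definition _ U V X Y (f : U -> X) (g : V -> Y) :=
  GRing.Linear.copy (tmap f g) (tlift (fun u v => pure (f u) (g v))).

HB.instance Definition _ U V :=
  bilinear_isBilinear.Build K U V (tensor U V) *:%R *:%R (@pure K U V)
    (@pure_bilinear K U V).

Lemma tlift_id U V (t : tensor U V) : tlift (@pure K U V) t = t.
Proof.
apply/matrixP=> p q; rewrite /tlift summxE (bigD1 p) //= summxE (bigD1 q) //=.
have freeU : free (vbasis {:U}) := basis_free (vbasisP _).
have freeV : free (vbasis {:V}) := basis_free (vbasisP _).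
rewrite !mxE !coord_free // !eqxx !mulr1 big1 => [|j /negPf neq_jq]; last first.
  by rewrite !mxE !coord_free // neq_jq mulr0 mulr0.
rewrite addr0 big1 ?addr0 // => i /negPf neq_ip; rewrite summxE big1 // => j _.
by rewrite !mxE !coord_free // neq_ip mul0r mulr0.
Qed.

Lemma eq_tlift U V W (beta gamma : U -> V -> W) :
  beta =2 gamma -> tlift beta =1 tlift gamma.
Proof.
by move=> eq_bg t; apply: eq_bigr => i _; apply: eq_bigr => j _; rewrite eq_bg.
Qed.

Lemma linear_tlift U V W W' (F : {linear W -> W'}) (beta : U -> V -> W) t :
  F (tlift beta t) = tlift (fun u v => F (beta u v)) t.
Proof.
rewrite linear_sum; apply: eq_bigr => i _; rewrite linear_sum.
by apply: eq_bigr => j _; rewrite linearZ.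
Qed.

Lemma tlift_tmap U V X Y W (f : U -> X) (g : V -> Y) (beta : X -> Y -> W) t :
    bilinear_for *:%R *:%R beta ->
  tlift beta (tmap f g t) = tlift (fun u v => beta (f u) (g v)) t.
Proof.
move=> bl; rewrite /tmap (linear_tlift (tlift beta)).
by apply: eq_tlift => u v /=; rewrite tlift_pure.
Qed.

(** The map F is a bare function, so that the lemma applies to expressions such
    as right multiplication by a fixed element, which carry no canonical linear
    structure. *)
Lemma linear_for_tlift U V W W' (F : W -> W') (beta : U -> V -> W) t :
  linear F -> F (tlift beta t) = tlift (fun u v => F (beta u v)) t.
Proof.
move=> linF.
pose L : {linear W -> W'} :=
  HB.pack_for {linear W -> W'} F (GRing.isLinear.Build K W W' *:%R F linF).
exact: (linear_tlift L).
Qed.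

Lemma pure_tliftl U V X Y (beta : U -> V -> X) (y : Y) t :
  pure (tlift beta t) y = tlift (fun u v => pure (beta u v) y) t.
Proof. exact: (linear_for_tlift _ _ ((pure_bilinear X Y).1 y)). Qed.

Lemma pure_tliftr U V X Y (beta : U -> V -> Y) (x : X) t :
  pure x (tlift beta t) = tlift (fun u v => pure x (beta u v)) t.
Proof. exact: (linear_for_tlift _ _ ((pure_bilinear X Y).2 x)). Qed.

Lemma tensor_ext U V W (F F' : tensor U V -> W) :
    linear F -> linear F' ->
  (forall u v, F (pure u v) = F' (pure u v)) -> F =1 F'.
Proof.
move=> linF linF' eqF t; rewrite -[t]tlift_id !linear_for_tlift //; exact: eq_tlift.
Qed.

Lemma tlift_sum (I : finType) U V W (beta : I -> U -> V -> W) t :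
  tlift (fun u v => \sum_i beta i u v) t = \sum_i tlift (beta i) t.
Proof.
rewrite /tlift [RHS]exchange_big; apply: eq_bigr => i _ /=.
by rewrite [RHS]exchange_big; apply: eq_bigr => j _; rewrite /= scaler_sumr.
Qed.

Lemma scalarZ W (f : {scalar W}) c x : f (c *: x) = c * f x.
Proof. exact: linearZ_LR. Qed.

Lemma pureZl U V c (u : U) (v : V) : pure (c *: u) v = c *: pure u v.
Proof. exact: linearZl_LR. Qed.

Lemma pureZr U V c (u : U) (v : V) : pure u (c *: v) = c *: pure u v.
Proof. exact: linearZr_LR. Qed.

Lemma tmap_pure U V X Y (f : {linear U -> X}) (g : {linear V -> Y}) u v :
  tmap f g (pure u v) = pure (f u) (g v).
Proof.
rewrite /tmap tlift_pure //; split=> [w|w] c x y.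
  by rewrite linearP (pure_bilinear X Y).1.
by rewrite linearP (pure_bilinear X Y).2.
Qed.

Definition trilinear U V X W (beta : U -> V -> X -> W) :=
  [/\ forall v x, linear (fun u => beta u v x),
      forall u x, linear (fun v => beta u v x)
    & forall u v, linear (beta u v)].

Lemma tlift_linear_arg U V X W (beta : X -> U -> V -> W) t :
  (forall u v, linear (fun x => beta x u v)) ->
  linear (fun x => tlift (beta x) t).
Proof.
move=> lin a x y; rewrite /tlift scaler_sumr -big_split; apply: eq_bigr => i _.
rewrite scaler_sumr -big_split; apply: eq_bigr => j _ /=.
by rewrite lin scalerDr !scalerA mulrC.
Qed.

(** Coassociativity in the form used by Sweedler computations: a trilinear
    expression in the three legs does not depend on which leg was split.  The
    two coproducts f and g may differ, which covers coactions as well. *)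
Lemma tassoc_tlift U V X Y Z W (f : Y -> tensor U V) (g : Z -> tensor V X)
    (s : tensor Y X) (t : tensor U Z) (beta : U -> V -> X -> W) :
    trilinear beta ->
    tassoc (tmap f id s) = tmap id g t ->
  tlift (fun y x => tlift (fun u v => beta u v x) (f y)) s =
  tlift (fun u z => tlift (beta u) (g z)) t.
Proof.
move=> [bu bv bx] assoc_st.
pose F u (r : tensor V X) := tlift (beta u) r.
have bF : bilinear_for *:%R *:%R F.
  split=> [r | u]; [exact: (tlift_linear_arg r bu) | exact: tlift_is_linear].
have := congr1 (tlift F) assoc_st; rewrite tlift_tmap //= => <-.
rewrite [RHS]linear_tlift.
under [RHS]eq_tlift => r x.
  rewrite linear_tlift.
  under eq_tlift => u v.
    rewrite /= tlift_pure // /F tlift_pure; last first.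
      by split=> [x' | v']; [exact: bv | exact: bx].
    over.
  over.
rewrite tlift_tmap //; split=> [x | r]; first exact: tlift_is_linear.
exact: (@tlift_linear_arg U V X W (fun x u v => beta u v x) r bx).
Qed.

End TensorCalculus.

(** * Traces of operators *)
Section OperatorTrace.
Variable K : fieldType.
Implicit Types U V W : vectType K.

(** Rows are the images of the basis vectors, so composition reverses the order
    of the matrix products. *)
Definition opmx U V (f : U -> V) : 'M_(\dim {:U}, \dim {:V}) :=
  \matrix_(i, j) coord (vbasis {:V}) j (f (vbasis {:U})`_i).

Lemma opmx_comp U V W (f : U -> V) (g : {linear V -> W}) :
  opmx (g \o f) = opmx f *m opmx g.
Proof.
apply/matrixP=> i j; rewrite !mxE /=.
rewrite {1}(coord_vbasis (memvf (f (vbasis {:U})`_i))) !linear_sum.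
by apply: eq_bigr => k _; rewrite !linearZ !mxE.
Qed.

Definition op_trace U (f : U -> U) : K := \tr (opmx f).

Lemma op_traceC U V (f : {linear U -> V}) (g : {linear V -> U}) :
  op_trace (g \o f) = op_trace (f \o g).
Proof. by rewrite /op_trace (opmx_comp f g) (opmx_comp g f) mxtrace_mulC. Qed.

Lemma eq_op_trace U (f g : U -> U) : f =1 g -> op_trace f = op_trace g.
Proof. by move=> eq_fg; apply: eq_bigr => i _; rewrite !mxE eq_fg. Qed.

(** The trace may be computed in any dual pair of families, here needed for the
    elementary tensors, which are not the chosen basis of the tensor square. *)
Lemma op_trace_dual U (I : finType) (e : I -> U) (phi : I -> U -> K)
    (f : U -> U) :
    (forall i, scalar (phi i)) -> linear f ->
    (forall x, x = \sum_i phi i x *: e i) ->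
  op_trace f = \sum_i phi i (f (e i)).
Proof.
move=> lin_phi lin_f dual_e.
pose Phi i : {scalar U} := HB.pack_for {scalar U} (phi i)
  (GRing.isLinear.Build K U K *%R (phi i) (lin_phi i)).
pose F : {linear U -> U} := HB.pack_for {linear U -> U} f
  (GRing.isLinear.Build K U U *:%R f lin_f).
rewrite -[op_trace f]/(op_trace F) -[RHS]/(\sum_i Phi i (F (e i))).
have {}dual_e x : x = \sum_i Phi i x *: e i by exact: dual_e.
rewrite /op_trace /mxtrace.
under eq_bigr => k _.
  rewrite mxE [(vbasis _)`_k]dual_e !linear_sum.
  under eq_bigr => i _ do rewrite !linearZ /=.
  over.
rewrite exchange_big; apply: eq_bigr => i _ /=.
rewrite -[RHS]/(Phi i (F (e i))) [in RHS](coord_vbasis (memvf (F (e i)))) linear_sum.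
by apply: eq_bigr => k _; rewrite linearZ mulrC.
Qed.

End OperatorTrace.

Section TraceSquare.
Variable C : numClosedFieldType.

(** In triangular form the trace of A^2 is the sum of the squares of the
    eigenvalues.  When it vanishes, so do all eigenvalues, and A is nilpotent by
    the Cayley-Hamilton theorem. *)
Lemma mxtrace_sqr_real_spectrum n (A : 'M[C]_n) :
    (forall a, eigenvalue A a -> a \is Num.real) ->
  0 <= \tr (A *m A) /\ (\tr (A *m A) = 0 -> A ^+ n = 0).
Proof.
case: n A => [|n] A realA.
  by rewrite /mxtrace big_ord0 lexx; split=> // _; apply: flatmx0.
have [//|P /unitarymx_unit unitP trigPA] := Schur A.
move: trigPA; rewrite /similar_to; move defT: (conjmx P A) => T trigPA.
have defA : A = invmx P *m T *m P.
  by rewrite -defT conjumx // !mulmxA mulVmx // mul1mx mulmxKV.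
have char_eq : char_poly A = char_poly T.
  rewrite /char_poly /char_poly_mx {1}defA.
  set P' := map_mx polyC P; set T' := map_mx polyC T.
  have unitP' : P' \in unitmx by rewrite map_unitmx.
  have -> : 'X%:M - map_mx polyC (invmx P *m T *m P) =
            invmx P' *m ('X%:M - T') *m P'.
    rewrite !map_mxM map_invmx mulmxBr mulmxBl -/P' -/T'; congr (_ - _).
    by rewrite scalar_mxC mulmxKV.
  by rewrite !det_mulmx mulrAC -det_mulmx mulVmx // det1 mul1r.
have zT := elimT is_trig_mxP trigPA; have charT := char_poly_trig trigPA.
have realT i : T i i \is Num.real.
  apply: realA; rewrite eigenvalue_root_char char_eq charT (bigD1 i) //=.
  by rewrite rootM root_XsubC eqxx.
have trA2 : \tr (A *m A) = \sum_i T i i ^+ 2.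
  rewrite {1 2}defA !mulmxA mxtrace_mulC !mulmxA mulmxV // mul1mx.
  rewrite mulmxK //; apply: eq_bigr => i _; rewrite mxE (bigD1 i) //= expr2.
  rewrite big1 ?addr0 // => j; rewrite neq_ltn => /orP[] lt_ij.
    by rewrite [T j i]zT ?mulr0.
  by rewrite [T i j]zT ?mul0r.
have sqr_ge0 i : 0 <= T i i ^+ 2 by rewrite real_exprn_even_ge0.
rewrite trA2; split=> [|tr0]; first exact: sumr_ge0.
have diag0 i : T i i = 0.
  have := tr0; move/eqP; rewrite psumr_eq0 => [/allP/(_ i)|//].
  by rewrite mem_index_enum => /(_ isT); rewrite expf_eq0 => /eqP.
rewrite -[RHS](Cayley_Hamilton A) char_eq charT.
under eq_bigr => i _ do rewrite diag0 subr0.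
by rewrite prodr_const card_ord rmorphXn /= horner_mx_X.
Qed.

End TraceSquare.

(** * The regular trace of a finite-dimensional C*-algebra *)
Section CstarAlgebra.
Variables (R : realType) (A : cstar_algebra R).
Local Notation C := R[i].
Local Notation norm := (@cstar_norm R A).
Implicit Types a b x y : A.

Lemma starD a b : star (a + b) = star a + star b.
Proof. by rewrite -[a]scale1r star_conj_linear conjC1 !scale1r. Qed.

Lemma star0 : star (0 : A) = 0.
Proof. by apply: (@addrI _ (star (0 : A))); rewrite -starD !addr0. Qed.

Lemma starZ c a : star (c *: a) = c^* *: star a.
Proof. by rewrite -[c *: a]addr0 star_conj_linear star0 addr0. Qed.

Lemma starN a : star (- a) = - star a.
Proof. by rewrite -scaleN1r starZ rmorphN1 scaleN1r. Qed.

Lemma starM a b : star (a * b) = star b * star a.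
Proof. exact: star_anti_mul. Qed.

Lemma starK : involutive (@star R A).
Proof. exact: star_involutive. Qed.

Lemma star1 : star (1 : A) = 1.
Proof. by rewrite -[RHS]starK -[in RHS](mulr1 (star 1)) starM starK mulr1. Qed.

Lemma star_sum I r (P : pred I) (F : I -> A) :
  star (\sum_(i <- r | P i) F i) = \sum_(i <- r | P i) star (F i).
Proof. exact: (big_morph _ starD star0). Qed.

Lemma cstar_norm0 : norm 0 = 0.
Proof.
by apply: complexI; rewrite -(scale0r 0) cstar_normZ normr0 mul0r.
Qed.

Lemma cstar_normN a : norm (- a) = norm a.
Proof.
by apply: complexI; rewrite -scaleN1r cstar_normZ normrN1 mul1r.
Qed.

Lemma cstar_norm_ge0 a : 0 <= norm a.
Proof.
have := cstar_norm_triangle a (- a); rewrite subrr cstar_norm0 cstar_normN.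
by rewrite -mulr2n pmulrn_lge0.
Qed.

Lemma cstar_norm1 : norm 1 = 1.
Proof.
have := cstar_identity (1 : A); rewrite star1 mul1r => /eqP.
rewrite expr2 -{1}[norm 1]mulr1 => /eqP /mulfI <- //.
by apply/negP=> /eqP /cstar_norm_eq0 /eqP; rewrite oner_eq0.
Qed.

(** If l = s + i t, then x + i r has the eigenvalue s + i (t + r), while the
    C*-identity bounds its squared norm by |x|^2 + r^2.  So
    s^2 + (t + r)^2 <= |x|^2 + r^2 for all real r, which forces t = 0. *)
Lemma selfadjoint_spectrum_real x v (l : C) :
  star x = x -> v != 0 -> x * v = l *: v -> l \is Num.real.
Proof.
move=> sax nzv; case: l => s t xv; rewrite complex_real.
have posv : 0 < norm v.
  rewrite lt_neqAle cstar_norm_ge0 andbT eq_sym.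
  by apply: contra nzv => /eqP/cstar_norm_eq0 ->.
have bound r : s ^+ 2 + (t + r) ^+ 2 <= norm x ^+ 2 + r ^+ 2.
  pose c : C := 0 +i* r; pose y := x + c *: 1.
  have yv : y * v = (s +i* (t + r)) *: v.
    rewrite mulrDl xv -scalerAl mul1r -scalerDl; congr (_ *: _).
    by apply/eqP; rewrite eq_complex /= addr0 !eqxx.
  have ny : norm y ^+ 2 <= norm x ^+ 2 + r ^+ 2.
    rewrite -cstar_identity.
    have -> : star y * y = star x * x + (r ^+ 2)%:C *: 1.
      rewrite /y starD starZ star1 sax mulrDl !mulrDr -!scalerAl -!scalerAr.
      rewrite !mul1r mulr1 scalerA -addrA; congr (_ + _).
      rewrite addrA -scalerDl.
      have -> : c + c^* = 0 by apply/eqP; rewrite eq_complex /= addr0 subrr !eqxx.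
      rewrite scale0r add0r; congr (_ *: _).
      apply/eqP; rewrite eq_complex /= !mul0r !mulr0 mulNr opprK add0r addr0.
      by rewrite expr2 !eqxx.
    apply: (le_trans (cstar_norm_triangle _ _)); rewrite cstar_identity lerD2l.
    rewrite -lecR cstar_normZ cstar_norm1 mulr1 ger0_norm // lecR.
    exact: sqr_ge0.
  apply: le_trans ny; rewrite -lecR (add_Re2_Im2 (s +i* (t + r))) rmorphXn /=.
  rewrite -(ler_pM2r (_ : 0 < (norm v)%:C ^+ 2)); last by rewrite exprn_gt0 ?ltcR.
  rewrite -!exprMn -cstar_normZ -yv -rmorphM lerXn2r ?nnegrE ?lecR ?ler0c //.
  - exact: cstar_norm_ge0.
  - by rewrite mulr_ge0 ?cstar_norm_ge0.
  - exact: cstar_norm_mul.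
(* This value of r makes the cross term 2 t r equal to |x|^2 + 1. *)
apply/negP => /negP nz_t; have := bound ((norm x ^+ 2 + 1) / (t *+ 2)).
set r := _ / _; have r2t : (t * r) *+ 2 = norm x ^+ 2 + 1.
  by rewrite -mulrnAl /r mulrC divfK // mulrn_eq0.
rewrite sqrrD r2t; apply/negP; rewrite -ltNge.
by have := sqr_ge0 s; have := sqr_ge0 t; lra.
Qed.

Definition reg_trace a : C := op_trace (fun x : A => a * x).

Lemma reg_trace_is_scalar : scalar reg_trace.
Proof.
move=> c a b; rewrite /reg_trace /op_trace /mxtrace mulr_sumr -big_split.
apply: eq_bigr => i _ /=; rewrite !mxE mulrDl -scalerAl linearP /=.
by [].
Qed.

HB.instance Definition _ :=
  GRing.isLinear.Build C A C *%R reg_trace reg_trace_is_scalar.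

Lemma reg_traceM a b : reg_trace (a * b) = reg_trace (b * a).
Proof.
rewrite /reg_trace.
pose l (a : A) : {linear A -> A} := a \*o @idfun A.
have := op_traceC (l a) (l b).
rewrite (@eq_op_trace _ _ (l b \o l a) (fun x => b * a * x)); last first.
  by move=> x; rewrite /= mulrA.
rewrite (@eq_op_trace _ _ (l a \o l b) (fun x => a * b * x)) //.
by move=> x; rewrite /= mulrA.
Qed.

(** The C*-identity makes the norm of x^(2^k) equal to the 2^k-th power of the
    norm of x. *)
Lemma selfadjoint_nilpotent0 x n : star x = x -> x ^+ n = 0 -> x = 0.
Proof.
move=> sax nil_x; suff: norm x ^+ (2 ^ n) = 0.
  by move/eqP; rewrite expf_eq0 => /andP[_ /eqP /cstar_norm_eq0].
have normX k : norm (x ^+ (2 ^ k)) = norm x ^+ (2 ^ k).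
  elim: k => [|k IHk]; first by rewrite !expr1.
  rewrite expnSr !exprM -IHk -cstar_identity; congr norm; rewrite expr2.
  congr (_ * _); elim: (2 ^ k)%N => [|m IHm]; first by rewrite expr0 star1.
  by rewrite {2}exprSr starM -IHm sax exprS.
(* Since n <= 2^n, the power x^(2^n) vanishes. *)
rewrite -normX -(subnK (ltnW (ltn_expl n (ltnSn 1)))) exprD nil_x mulr0.
exact: cstar_norm0.
Qed.

Lemma reg_trace_sqr x : star x = x ->
  0 <= reg_trace (x * x) /\ (reg_trace (x * x) = 0 -> x = 0).
Proof.
move=> sax; pose l : {linear A -> A} := x \*o @idfun A.
have mxX k : opmx l ^+ k = opmx (fun y : A => x ^+ k * y).
  elim: k => [|k IHk].
    rewrite expr0; apply/matrixP=> i j; rewrite !mxE expr0 mul1r.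
    by rewrite coord_free ?(basis_free (vbasisP _)).
  rewrite exprSr IHk -[LHS]/(opmx (fun y : A => x ^+ k * y) *m opmx l).
  rewrite -opmx_comp; congr opmx.
  by apply: funext => y /=; rewrite exprS mulrA.
have trE : reg_trace (x * x) = \tr (opmx l *m opmx l).
  by rewrite -[opmx l *m _]/(opmx l ^+ 2) mxX.
have [a|] := @mxtrace_sqr_real_spectrum _ _ (opmx l).
  case/eigenvalueP=> v /rowP vl nzv.
  pose e := vbasis {:A}; pose y := \sum_i v 0 i *: e`_i.
  apply: (@selfadjoint_spectrum_real x y) => //.
    apply: contra nzv => /eqP y0; apply/eqP/rowP=> i; rewrite mxE.
    by have /freeP/(_ (v 0) y0 i) := basis_free (vbasisP {:A}).
  rewrite /y mulr_sumr scaler_sumr.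
  under eq_bigr => i _.
    rewrite -scalerAr [x * _](coord_vbasis (memvf _)) scaler_sumr.
    over.
  rewrite exchange_big; apply: eq_bigr => j _ /=.
  move: (vl j); rewrite !mxE => {vl} vl.
  under eq_bigr => i _ do rewrite scalerA.
  rewrite -scaler_suml scalerA -vl; congr (_ *: _).
  by apply: eq_bigr => i _; rewrite mxE.
rewrite -trE => ge0 eq0; split=> // /eq0 nil_l.
apply: (@selfadjoint_nilpotent0 x (\dim {:A})) => //.
move: nil_l; rewrite mxX => /matrixP nil_l.
rewrite -[LHS]mulr1 [1](coord_vbasis (memvf _)) mulr_sumr big1 // => i _.
rewrite -scalerAr [X in _ *: X](coord_vbasis (memvf _)) big1 ?scaler0 // => j _.
by have := nil_l i j; rewrite !mxE => ->; rewrite scale0r.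
Qed.

(** With re = a + star a and im = i (a - star a), the trace property turns the
    trace of re^2 + im^2 into four times that of star a * a. *)
Lemma reg_trace_ge0 a : 0 <= reg_trace (star a * a) /\
  (reg_trace (star a * a) = 0 -> a = 0).
Proof.
pose re := a + star a; pose im := 'i *: (a - star a).
have sre : star re = re by rewrite /re starD starK addrC.
have sim : star im = im.
  rewrite /im starZ starD starN starK.
  by rewrite conjCi scaleNr -scalerN opprB.
have [re_ge0 re_eq0] := reg_trace_sqr sre.
have [im_ge0 im_eq0] := reg_trace_sqr sim.
have ii : Num.imaginary * Num.imaginary = -1 :> C by rewrite -expr2 sqrCi.
have sumE : reg_trace (re * re) + reg_trace (im * im) =
            reg_trace (star a * a) *+ 4.
  rewrite /re /im -scalerAl -scalerAr scalerA [X in X *: _]ii scaleN1r.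
  rewrite !(mulrDl, mulrDr, mulrN, mulNr) /=.
  rewrite !(raddfD reg_trace, raddfN reg_trace) /=.
  by rewrite [reg_trace (a * star a)]reg_traceM; ring.
split=> [|tr0].
  by rewrite -(pmulrn_lge0 _ (isT : 0 < 4)%N) -sumE addr_ge0.
have /eqP := sumE; rewrite tr0 mul0rn paddr_eq0 // => /andP[/eqP/re_eq0 re0].
move=> /eqP/im_eq0 /eqP; rewrite scaler_eq0 (negPf (neq0Ci _)) subr_eq0 => /eqP sa.
move: re0; rewrite /re -sa -mulr2n => /eqP.
by rewrite -scaler_nat scaler_eq0 pnatr_eq0 => /eqP.
Qed.

End CstarAlgebra.

(** * Orthonormal bases and states *)
Section OrthonormalBasis.
Variables (C : numClosedFieldType) (V : vectType C) (ip : {dot V for conjC}).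

(** Pairing with a basis of U is a linear map into a space of dimension dim U,
    which is too small for it to be injective. *)
Lemma orthogonal_neq0 (U : {vspace V}) :
  U != fullv -> exists2 v, v != 0 & {in U, forall u, ip v u = 0}.
Proof.
move=> properU; pose e := vbasis U.
pose f v := \row_(i < \dim U) ip v e`_i.
have lin_f : linear f by move=> c x y; apply/rowP => i; rewrite !mxE linearPl.
pose F : {linear V -> 'rV[C]_(\dim U)} :=
  HB.pack_for {linear V -> 'rV[C]_(\dim U)} f
    (GRing.isLinear.Build C V 'rV[C]_(\dim U) *:%R f lin_f).
have: lker (linfun F) != 0%VS.
  apply: contraNneq properU => ker0; rewrite eqEdim subvf /=.
  have := limg_ker_dim (linfun F) fullv; rewrite ker0 capv0 dimv0 add0n => <-.
  by apply: leq_trans (dimvS (subvf _)) _; rewrite dimvf /dim /= mul1n.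
case: (boolP (vpick (lker (linfun F)) == 0)) => [|nz_v _]; first by rewrite vpick0 => ->.
exists (vpick (lker (linfun F))) => // u Uu.
have := memv_pick (lker (linfun F)); rewrite memv_ker lfunE /= => /eqP/rowP Fv.
rewrite (coord_vbasis Uu) linear_sumr big1 // => i _.
by have := Fv i; rewrite !mxE linearZr_LR /= => ->; rewrite mulr0.
Qed.

Lemma orthonormal_basis_exists :
  exists e : (\dim {:V}).-tuple V, orthonormal ip e.
Proof.
have ext n : (n <= \dim {:V})%N -> exists e : n.-tuple V, orthonormal ip e.
  elim: n => [|n IHn] lt_n; first by exists [tuple].
  have [e oe] := IHn (ltnW lt_n).
  have [|v nzv ov] := @orthogonal_neq0 <<e>>%VS.
    apply: contraTneq lt_n => spanV; rewrite -leqNgt -spanV.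
    by rewrite (leq_trans (dim_span e)) // size_tuple.
  pose c := (sqrtC (ip v v))^-1.
  exists [tuple of c *: v :: e]; rewrite /= -[_ :: _]cat1s orthonormal_cat oe /=.
  apply/andP; split.
    rewrite /orthonormal /= !andbT linearZl_LR linearZr_LR /= mulrA.
    have cc : conjC c = c.
      by apply/eqP; rewrite -CrealE realV ger0_real // sqrtC_ge0 dnorm_ge0.
    rewrite cc /c -invfM -expr2 sqrtCK mulVf // dnorm_eq0 //.
  rewrite andbT; apply/allP=> y ey; apply/eqP.
  by rewrite /= linearZl_LR /= ov ?mulr0 // memv_span.
exact: ext.
Qed.

Section Expansion.
Variables (e : (\dim {:V}).-tuple V) (oe : orthonormal ip e).

Lemma orthonormalE_tnth i j : ip (tnth e i) (tnth e j) = (i == j)%:R.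
Proof.
have /orthonormalP[uniq_e ->] := oe; rewrite ?mem_tnth //.
by rewrite !(tnth_nth 0) nth_uniq ?size_tuple.
Qed.

Lemma orthonormal_expand x : x = \sum_i ip x (tnth e i) *: tnth e i.
Proof.
have be : basis_of fullv e.
  by rewrite basisEfree (orthonormal_free oe) subvf size_tuple leqnn.
have -> : x = \sum_i coord e i x *: tnth e i.
  rewrite {1}(coord_basis be (memvf x)); apply: eq_bigr => i _.
  by rewrite (tnth_nth 0).
apply: eq_bigr => i _; congr (_ *: _).
rewrite linear_sumlz (bigD1 i) //= linearZl_LR /= orthonormalE_tnth eqxx mulr1.
rewrite big1 ?addr0 // => j /negPf nij.
by rewrite linearZl_LR /= orthonormalE_tnth nij mulr0.
Qed.

Lemma tensor_expandl (W : vectType C) (t : tensor V W) :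
  t = \sum_i pure (tnth e i) (tlift (fun v w => ip v (tnth e i) *: w) t).
Proof.
rewrite -{1}[t]tlift_id {1}/tlift.
transitivity (tlift (fun v w => \sum_i pure (tnth e i) (ip v (tnth e i) *: w)) t).
  apply: eq_tlift => v w; rewrite {1}[v]orthonormal_expand linear_sumlz.
  by apply: eq_bigr => i _; rewrite linearZl_LR linearZr_LR.
under [RHS]eq_bigr => i _ do rewrite pure_tliftr.
by rewrite tlift_sum.
Qed.

Lemma tensor_expandr (W : vectType C) (t : tensor W V) :
  t = \sum_i pure (tlift (fun w v => ip v (tnth e i) *: w) t) (tnth e i).
Proof.
rewrite -{1}[t]tlift_id {1}/tlift.
transitivity (tlift (fun w v => \sum_i pure (ip v (tnth e i) *: w) (tnth e i)) t).
  apply: eq_tlift => w v; rewrite {1}[v]orthonormal_expand linear_sumr.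
  by apply: eq_bigr => i _; rewrite linearZl_LR linearZr_LR.
under [RHS]eq_bigr => i _ do rewrite pure_tliftl.
by rewrite tlift_sum.
Qed.

End Expansion.
End OrthonormalBasis.

Section PositiveFunctional.
Variables (R : realType) (A : cstar_algebra R) (mu : {scalar A}).
Hypothesis mu_ge0 : forall a : A, 0 <= mu (star a * a).
Local Notation C := R[i].
Implicit Types a b x y : A.

(** For every scalar c, expanding the positive number
    mu (star (a + c 1) * (a + c 1)) shows that c mu(star a) + c^* mu(a) is real;
    the cases c = 1 and c = i determine mu(star a). *)
Lemma positive_star a : mu (star a) = conjC (mu a).
Proof.
have cross_real (c : C) : c * mu (star a) + conjC c * mu a \is Num.real.
  have -> : c * mu (star a) + conjC c * mu a =
      mu (star (a + c *: 1) * (a + c *: 1)) - mu (star a * a)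
      - conjC c * c * mu (star 1 * 1).
    have -> : star (a + c *: 1) * (a + c *: 1) =
        star a * a + c *: star a + (conjC c *: a + (conjC c * c) *: 1).
      rewrite starD starZ star1 mulrDl !mulrDr -!scalerAl -!scalerAr.
      by rewrite !mul1r !mulr1 scalerA.
    by rewrite !(linearD mu) !(scalarZ mu) star1 mul1r; ring.
  have re := ger0_real (mu_ge0 _).
  by rewrite !rpredB // rpredM // -normCKC ger0_real // exprn_ge0.
have := cross_real 1; have := cross_real Num.imaginary.
rewrite !CrealE conjC1 !mul1r !rmorphD !rmorphM /= !conjCK !conjCi.
move: (mu (star a)) (mu a) => p q /eqP eq_i /eqP eq_1.
have /eqP : Num.imaginary * (conjC q - conjC p - p + q) = 0 :> C.
  transitivity (- Num.imaginary * conjC p + Num.imaginary * conjC q -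
    (Num.imaginary * p + - Num.imaginary * q)); last by rewrite eq_i subrr.
  by ring.
rewrite mulf_eq0 (negPf (neq0Ci _)) => /eqP diff0.
have dbl : (p == conjC q) = ((p - conjC q) *+ 2 == 0).
  by rewrite mulrn_eq0 subr_eq0.
apply/eqP; rewrite dbl.
apply/eqP; transitivity (p + q - (conjC p + conjC q) - (conjC q - conjC p - p + q)).
  by ring.
by rewrite eq_1 subrr diff0 subr0.
Qed.

Definition state_form x y : C := mu (star y * x).

Hypothesis mu_faithful : forall a : A, mu (star a * a) = 0 -> a = 0.

Lemma state_form_bilinear : bilinear_for *%R (conjC \; *%R) state_form.
Proof.
split=> [y | x] c a b; rewrite /state_form.
  by rewrite mulrDr -scalerAr linearP.
by rewrite starD starZ mulrDl -scalerAl linearP.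
Qed.

Lemma state_form_hermitian x y :
  state_form x y = (-1) ^+ false * conjC (state_form y x).
Proof. by rewrite expr0 mul1r -positive_star starM starK. Qed.

Lemma state_form_gt0 x : x != 0 -> 0 < state_form x x.
Proof.
move=> nz_x; rewrite lt_def mu_ge0 andbT.
by apply: contra nz_x => /eqP/mu_faithful ->.
Qed.

Definition state_dot : {dot A for conjC} :=
  HB.pack_for {dot A for conjC} state_form
    (bilinear_isBilinear.Build C A A C *%R (conjC \; *%R) state_form state_form_bilinear)
    (isHermitianSesquilinear.Build C A false conjC state_form state_form_hermitian)
    (isDotProduct.Build C A state_form state_form_gt0).

End PositiveFunctional.

(** * The regular trace of a Hopf algebra is idempotent *)
Section TensorAlgebra.
Variables (K : fieldType) (A : falgType K).

Lemma tmul_bilinear : bilinear_for *:%R *:%R (@tmul K A).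
Proof.
split=> [t | s]; first exact: tlift_is_linear.
by apply: tlift_linear_arg => a b; apply: tlift_is_linear.
Qed.

HB.instance Definition _ :=
  bilinear_isBilinear.Build K (tensor A A) (tensor A A) (tensor A A) *:%R *:%R
    (@tmul K A) tmul_bilinear.

Lemma tmulA (s t r : tensor A A) : tmul s (tmul t r) = tmul (tmul s t) r.
Proof.
have [tl tr] := tmul_bilinear.
move: s; apply: (@tensor_ext _ _ _ _ (fun s => tmul s (tmul t r))
  (fun s => tmul (tmul s t) r)) => [c x y|c x y|a b]; rewrite ?tl //.
move: t; apply: (@tensor_ext _ _ _ _ (fun t => tmul (pure a b) (tmul t r))
  (fun t => tmul (tmul (pure a b) t) r)) => [k x y|k x y|c d].
- by rewrite tl tr.
- by rewrite tr tl.
move: r; apply: (@tensor_ext _ _ _ _ (fun r => tmul _ (tmul _ r))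
  (fun r => tmul _ r)) => [k x y|k x y|e f]; rewrite ?tr //.
by rewrite !tmul_pure !mulrA.
Qed.

Lemma op_trace_tmul (tau : {scalar A}) (s : tensor A A) :
    (forall a, tau a = op_trace (fun x : A => a * x)) ->
  op_trace (tmul s) = tlift (fun u v => tau u * tau v : K^o) s.
Proof.
move=> tauE; have [tl tr] := tmul_bilinear.
move: s; apply: (@tensor_ext _ _ _ K^o (fun s => op_trace (tmul s))
  (tlift (fun u v => tau u * tau v : K^o))) => [c s t||a b].
- rewrite /op_trace /mxtrace scaler_sumr -big_split; apply: eq_bigr => i _.
  by rewrite !mxE tl linearP.
- exact: tlift_is_linear.
pose n := \dim {:A}; pose coef (ij : 'I_n * 'I_n) (t : tensor A A) : K := t ij.1 ij.2.
have coef_lin ij : scalar (coef ij) by move=> c s t; rewrite /coef !mxE.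
pose bb (ij : 'I_n * 'I_n) := pure (vbasis {:A})`_ij.1 (vbasis {:A})`_ij.2.
rewrite (op_trace_dual (e := bb) coef_lin (tr (pure a b))) => [|t]; last first.
  rewrite -(pair_bigA _ (fun i j => t i j *: bb (i, j))).
  by rewrite -/(tlift _ t) tlift_id.
rewrite tlift_pure; last first.
  split=> [v|u] c x y; rewrite linearP /=.
    by rewrite mulrDl -mulrA.
  by rewrite mulrDr mulrCA.
rewrite !tauE /op_trace /mxtrace big_distrl /=.
rewrite -(pair_bigA _ (fun i j => coef (i, j) (tmul _ (bb (i, j))))) /=.
apply: eq_bigr => i _; rewrite big_distrr; apply: eq_bigr => j _ /=.
by rewrite /coef /= tmul_pure !mxE.
Qed.

End TensorAlgebra.

Section HopfAlgebra.
Variables (R : realType) (G : finite_quantum_group R).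
Local Notation C := R[i].
Local Notation Delta := (comult G).
Local Notation eps := (counit G).
Local Notation tau := (@reg_trace R G).
Implicit Types a b x y : G.

Lemma comult_coassoc (W : lmodType C) (beta : G -> G -> G -> W) a :
    trilinear beta ->
  tlift (fun x z => tlift (fun x1 x2 => beta x1 x2 z) (Delta x)) (Delta a) =
  tlift (fun x y => tlift (beta x) (Delta y)) (Delta a).
Proof. by move=> tri; apply: tassoc_tlift tri (comultA a). Qed.

(* x (x) y |-> x_1 (x) f(x_2) y *)
(** For f the identity this is the Galois map of the Hopf algebra,
    x (x) y |-> Delta(x) (1 (x) y); for f the antipode it is its inverse. *)
Definition galois (f : G -> G) : tensor G G -> tensor G G :=
  tlift (fun x y => tlift (fun u v => pure u (f v * y)) (Delta x)).

Lemma galois_linear f : linear (galois f).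
Proof. exact: tlift_is_linear. Qed.

Lemma galois_pure f x y : linear f ->
  galois f (pure x y) = tlift (fun u v => pure u (f v * y)) (Delta x).
Proof.
move=> linf; rewrite /galois tlift_pure //; split=> [v | u].
  by move=> c a b; rewrite linearP tlift_is_linear.
apply: tlift_linear_arg => a b c s t.
by rewrite mulrDr -scalerAr (pure_bilinear G G).2.
Qed.

Lemma galoisK (f g : {linear G -> G}) :
    (forall a, tlift (fun b c => f b * g c) (Delta a) = eps a *: 1) ->
  cancel (galois g) (galois f).
Proof.
move=> inv_fg.
have linf : linear f by move=> c a b; rewrite linearP.
have ling : linear g by move=> c a b; rewrite linearP.
have [pl pr] := pure_bilinear G G.
apply: tensor_ext => [||x y]; first by move=> c s t; rewrite !galois_linear.
  by [].
rewrite galois_pure //.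
rewrite (linear_for_tlift _ _ (galois_linear f)).
under eq_tlift => u v do rewrite galois_pure //.
rewrite (@comult_coassoc _ (fun u v w => pure u (f v * (g w * y)))); last first.
  split=> [v w|u w|u v] c a b; first by rewrite pl.
    by rewrite linearP mulrDl -scalerAl pr.
  by rewrite linearP mulrDl -scalerAl mulrDr -scalerAr pr.
under eq_tlift => u v.
  under eq_tlift => v1 v2 do rewrite mulrA.
  rewrite -pure_tliftr.
  over.
transitivity (tlift (fun u v => pure (eps v *: u) y) (Delta x)).
  apply: eq_tlift => u v; rewrite pureZl -pureZr; congr pure.
  have lin_y : linear (fun z : G => z * y).
    by move=> c a b; rewrite mulrDl -scalerAl.
  by rewrite -(linear_for_tlift _ _ lin_y) inv_fg -scalerAl mul1r.
by rewrite -pure_tliftl counit_right.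
Qed.

(** The Galois map V satisfies Delta(a) V = V (a (x) 1), so left multiplication
    by Delta(a) and by a (x) 1 have the same trace on the tensor square. *)
Lemma reg_trace_conv a :
  tlift (fun u v => tau u * tau v : C^o) (Delta a) =
  tau a * tau 1.
Proof.
have [tl tr] := tmul_bilinear G.
rewrite -(@op_trace_tmul _ G tau) //.
have idK : cancel (galois (antipode G)) (galois idfun).
  by apply: galoisK => b; apply: antipode_right.
have SK : cancel (galois idfun) (galois (antipode G)).
  by apply: galoisK => b; apply: antipode_left.
have galE (s : tensor G G) y :
    tlift (fun u v => pure u (v * y)) s = tmul s (pure 1 y).
  move: s; apply: (@tensor_ext _ _ _ _ _ (fun s => tmul s (pure 1 y))).
  - exact: tlift_is_linear.
  - exact: tl.
  move=> u v; rewrite tmul_pure mulr1 tlift_pure //.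
  split=> [w|w] c s t; first by rewrite (pure_bilinear G G).1.
  by rewrite mulrDl -scalerAl (pure_bilinear G G).2.
have intertwine t : tmul (Delta a) (galois idfun t) = galois idfun (tmul (pure a 1) t).
  move: t; apply: (@tensor_ext _ _ _ _ (fun t => tmul (Delta a) (galois idfun t))
    (fun t => galois idfun (tmul (pure a 1) t))) => [c s t|c s t|x y].
  - by rewrite galois_linear tr.
  - by rewrite tr galois_linear.
  rewrite tmul_pure mul1r !galois_pure // !galE comultM.
  exact: tmulA.
pose V : {linear tensor G G -> tensor G G} :=
  HB.pack_for {linear tensor G G -> tensor G G} (galois idfun)
    (GRing.isLinear.Build C (tensor G G) (tensor G G) *:%R _ (galois_linear idfun)).
pose F0 (t : tensor G G) := tmul (pure a 1) (galois (antipode G) t).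
have lin_F : linear F0 by move=> c s t; rewrite /F0 galois_linear tr.
pose F : {linear tensor G G -> tensor G G} :=
  HB.pack_for {linear tensor G G -> tensor G G} F0
    (GRing.isLinear.Build C (tensor G G) (tensor G G) *:%R F0 lin_F).
transitivity (op_trace (V \o F)).
  by apply: eq_op_trace => t; rewrite /= /F0 -intertwine idK.
rewrite op_traceC.
transitivity (op_trace (tmul (pure a 1) : tensor G G -> tensor G G)).
  by apply: eq_op_trace => t; rewrite /= /F0 SK.
rewrite (@op_trace_tmul _ G tau) // tlift_pure //.
split=> [v|u] c x y; rewrite linearP /=.
  by rewrite mulrDl -mulrA.
by rewrite mulrDr mulrCA.
Qed.

Lemma reg_trace1_gt0 : 0 < tau (1 : G).
Proof.
have [] := @reg_trace_ge0 R G 1; rewrite star1 mul1r => ge0 eq0.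
rewrite lt_def ge0 andbT; apply/eqP => /eq0 /eqP.
by rewrite oner_eq0.
Qed.

Definition ntrace a : C := (tau (1 : G))^-1 * tau a.

Lemma ntrace_is_scalar : scalar ntrace.
Proof. by move=> c a b; rewrite /ntrace linearP /= mulrDr mulrCA. Qed.

HB.instance Definition _ := GRing.isLinear.Build C G C *%R ntrace ntrace_is_scalar.

Lemma ntrace_state : is_state ntrace.
Proof.
split=> [|a]; first by rewrite /= /ntrace mulVf // gt_eqF // reg_trace1_gt0.
rewrite /= /ntrace mulr_ge0 ?(reg_trace_ge0 a).1 // invr_ge0 ltW //.
exact: reg_trace1_gt0.
Qed.

Lemma ntrace_faithful a : ntrace (star a * a) = 0 -> a = 0.
Proof.
move/eqP; rewrite mulf_eq0 invr_eq0 gt_eqF ?reg_trace1_gt0 //= => /eqP.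
exact: (reg_trace_ge0 a).2.
Qed.

Lemma ntraceM a b : ntrace (a * b) = ntrace (b * a).
Proof. by rewrite /ntrace reg_traceM. Qed.

Lemma ntrace_conv a :
  tlift (fun u v => ntrace u * ntrace v : C^o) (Delta a) = ntrace a.
Proof.
have nz1 : tau (1 : G) != 0 by rewrite gt_eqF ?reg_trace1_gt0.
transitivity ((tau (1 : G))^-1 ^+ 2 *
    tlift (fun u v => tau u * tau v : C^o) (Delta a)).
  rewrite /tlift mulr_sumr; apply: eq_bigr => i _; rewrite mulr_sumr.
  by apply: eq_bigr => j _; rewrite /ntrace /GRing.scale /=; ring.
by rewrite reg_trace_conv /ntrace expr2 -mulrA mulrCA [_ * tau 1]mulrC mulKf // mulrC.
Qed.

End HopfAlgebra.

(** * Invariance of the normalised trace *)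
Section HaarState.
Variables (R : realType) (G : finite_quantum_group R).
Local Notation C := R[i].
Local Notation Delta := (comult G).
Local Notation eps := (counit G).
Implicit Types a b x y : G.

Lemma tstar_sum (I : finType) (x y : I -> G) :
  tstar (\sum_i pure (x i) (y i)) = \sum_i pure (star (x i)) (star (y i)).
Proof.
rewrite /tstar raddf_sum linear_sum; apply: eq_bigr => i _.
exact: tstar_pure.
Qed.

Lemma tmul_sum (I J : finType) (x y : I -> G) (z w : J -> G) :
  tmul (\sum_i pure (x i) (y i)) (\sum_j pure (z j) (w j)) =
  \sum_i \sum_j pure (x i * z j) (y i * w j).
Proof.
rewrite linear_sumlz; apply: eq_bigr => i _; rewrite linear_sumr.
by apply: eq_bigr => j _; rewrite /= tmul_pure.
Qed.

Lemma tlift_sum_pure (I : finType) (U V : vectType C) (W : lmodType C)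
    (x : I -> U) (y : I -> V) (beta : U -> V -> W) :
    bilinear_for *:%R *:%R beta ->
  tlift beta (\sum_i pure (x i) (y i)) = \sum_i beta (x i) (y i).
Proof.
by move=> bl; rewrite linear_sum; apply: eq_bigr => i _; rewrite /= tlift_pure.
Qed.

Lemma scalar_bilinear (U V : vectType C) (mu : {scalar U}) (nu : {scalar V}) :
  bilinear_for *:%R *:%R (fun u v => mu u * nu v : C^o).
Proof.
split=> [v|u] c x y; rewrite linearP /= /GRing.scale /=.
  by rewrite mulrDl -mulrA.
by rewrite mulrDr mulrCA.
Qed.

Lemma rslice_bilinear (U V : vectType C) (mu : {scalar V}) :
  bilinear_for *:%R *:%R (fun (u : U) v => mu v *: u).
Proof.
split=> [v|u] c x y; first by rewrite scalerDr scalerA mulrC -scalerA.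
by rewrite linearP /= scalerDl scalerA.
Qed.

Lemma slice_bilinear (U V : vectType C) (mu : {scalar U}) :
  bilinear_for *:%R *:%R (fun u (v : V) => mu u *: v).
Proof.
split=> [v|u] c x y; first by rewrite linearP /= scalerDl scalerA.
by rewrite scalerDr scalerA mulrC -scalerA.
Qed.

Lemma ntrace_dot : exists ip : {dot G for conjC},
  forall x y, ip x y = ntrace (star y * x).
Proof. by exists (state_dot (@ntrace_state R G).2 (@ntrace_faithful R G)). Qed.

(** Expand Delta(b) as the sum of x_j (x) e_j in an orthonormal basis e.  Since
    b is fixed by E = (t (x) id) Delta and t is idempotent, t (star b * b) is
    both the sum of the t (star x_j * x_j) and the sum of the |t(x_j)|^2.  So
    every x_j - t(x_j) 1 has norm zero, that is, Delta(b) = 1 (x) b. *)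
Lemma ntrace_left_invariant a :
  tlift (fun u v => ntrace u *: v) (Delta a) = ntrace a *: 1.
Proof.
pose t := @ntrace R G; pose E a := tlift (fun u v => t u *: v) (Delta a).
have linE : linear E by move=> c x y; rewrite /E linearP tlift_is_linear.
have tE x : t (E x) = t x.
  rewrite -[RHS]ntrace_conv /E (linear_for_tlift (W' := C^o)) => [|c u v]; last first.
    by rewrite /t linearP.
  by apply: eq_tlift => u v; rewrite /t scalarZ.
have EE x : E (E x) = E x.
  rewrite -{1}[E x]/(tlift (fun u v => t u *: v) (Delta x)) (linear_for_tlift _ _ linE).
  transitivity (tlift (fun u v => tlift (fun v1 v2 => (t u * t v1) *: v2) (Delta v))
                 (Delta x)).
    apply: eq_tlift => u v; rewrite (scalable_linear linE) /= /E.
    have linS : linear (fun z : G => t u *: z).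
      by move=> c y z /=; rewrite scalerDr scalerA mulrC -scalerA.
    by rewrite (linear_for_tlift _ _ linS); apply: eq_tlift => v1 v2; rewrite scalerA.
  rewrite -(@comult_coassoc R G _ (fun u v w => (t u * t v) *: w)); last first.
    split=> [v w|u w|u v] c y z; rewrite /t.
    - by rewrite linearP /= mulrDl scalerDl -mulrA !scalerA.
    - by rewrite linearP /= mulrDr mulrCA scalerDl -!scalerA.
    - by rewrite scalerDr scalerA [_ * c]mulrC -[(c * _) *: y]scalerA.
  apply: eq_tlift => u v; rewrite -[X in X *: _]ntrace_conv.
  have linS : linear (fun c : C^o => c *: v).
    by move=> c y z /=; rewrite scalerDl scalerA.
  by rewrite (linear_for_tlift _ _ linS).
have [ip ipE] := ntrace_dot.
have [e oe] := orthonormal_basis_exists ip.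
pose b := E a; pose x j := tlift (fun w v => ip v (tnth e j) *: w) (Delta b).
have Db : Delta b = \sum_j pure (x j) (tnth e j) := tensor_expandr oe (Delta b).
have bE : b = \sum_j t (x j) *: tnth e j.
  transitivity (tlift (fun u v => t u *: v) (Delta b)); first exact: esym (EE a).
  by rewrite Db (tlift_sum_pure x (tnth e)) //; apply: slice_bilinear.
have tbb : t (star b * b) = \sum_j t (star (x j) * x j).
  rewrite -{1}[t _]ntrace_conv comultM comult_star Db tstar_sum tmul_sum.
  rewrite linear_sum; apply: eq_bigr => j _; rewrite /= tlift_sum_pure; last first.
    exact: scalar_bilinear.
  have tee k : ntrace (star (tnth e j) * tnth e k) = (k == j)%:R.
    by rewrite -ipE orthonormalE_tnth.
  rewrite (bigD1 j) //= tee eqxx mulr1 big1 ?addr0 // => k /negPf neq_kj.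
  by rewrite tee neq_kj mulr0.
have tbb' : t (star b * b) = \sum_j conjC (t (x j)) * t (x j).
  transitivity (ip b b); first by rewrite ipE.
  rewrite {1}bE linear_sumlz; apply: eq_bigr => j _.
  rewrite linearZl_LR /= mulrC; congr (_ * _); rewrite bE linear_sumr (bigD1 j) //=.
  rewrite linearZr_LR /= orthonormalE_tnth // eqxx mulr1 big1 ?addr0 // => k.
  by rewrite linearZr_LR /= orthonormalE_tnth // eq_sym => /negPf ->; rewrite mulr0.
pose y j := x j - t (x j) *: 1.
have tyy j : t (star (y j) * y j) = t (star (x j) * x j) - conjC (t (x j)) * t (x j).
  have -> : star (y j) * y j = star (x j) * x j +
      (- conjC (t (x j)) *: x j + (- t (x j) *: star (x j) +
       (conjC (t (x j)) * t (x j)) *: 1)).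
    rewrite /y; move: (t (x j)) => c; rewrite starD starN starZ star1.
    rewrite mulrDl !mulrDr !mulrN !mulNr -!scalerAl.
    rewrite -!scalerAr !mul1r !mulr1 opprK scalerA !scaleNr -addrA; congr (_ + _).
    by rewrite addrCA.
  have [_ t_ge0] := @ntrace_state R G.
  rewrite /t !(linearD (@ntrace R G)) !(scalarZ (@ntrace R G)) (positive_star t_ge0).
  by rewrite (@ntrace_state R G).1; ring.
have x_scalar j : x j = t (x j) *: 1.
  apply/eqP; rewrite -subr_eq0; apply/eqP/ntrace_faithful.
  have /eqP : \sum_j t (star (y j) * y j) = 0.
    by under eq_bigr => k _ do rewrite tyy; rewrite big_split sumrN /= -tbb tbb' subrr.
  rewrite psumr_eq0 => [/allP/(_ j)|k _]; last exact: (@ntrace_state R G).2.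
  by rewrite mem_index_enum => /(_ isT)/eqP.
have Db1 : Delta b = pure 1 b.
  rewrite Db [in RHS]bE linear_sumr; apply: eq_bigr => j _.
  by rewrite /= {1}x_scalar pureZl pureZr.
have b_scalar : b = eps b *: 1.
  rewrite -{1}[b]counit_right Db1 tlift_pure //.
  split=> [v|u] c z w; first by rewrite scalerDr scalerA mulrC -scalerA.
  by rewrite linearP /= scalerDl scalerA.
rewrite -/(E a) -/b {1}b_scalar; congr (_ *: _).
have <- : t b = ntrace a := tE a.
by rewrite {2}b_scalar /t scalarZ (@ntrace_state R G).1 mulr1.
Qed.

(** The convolution of t with h is both of them: h absorbs the state t, and t is
    left invariant. *)
Lemma haar_ntrace (h : {scalar G}) : is_haar h -> h =1 @ntrace R G.
Proof.
case=> [[h1 _]] /(_ _ (ntrace_state G))[_ h_inv] a.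
rewrite -h_inv /= /conv_fun.
have -> : tlift (fun u v => ntrace u * h v : C^o) (Delta a) =
          h (tlift (fun u v => ntrace u *: v) (Delta a)).
  rewrite (linear_for_tlift (W' := C^o)) => [|c u v]; last by rewrite linearP.
  by apply: eq_tlift => u v; rewrite scalarZ.
by rewrite ntrace_left_invariant scalarZ h1 mulr1.
Qed.

End HaarState.

(** * Representations and their coefficients *)
Section Slices.
Variables (R : realType) (G : finite_quantum_group R).
Local Notation C := R[i].

Definition slice (V : vectType C) (phi : G -> C) (t : tensor V G) : V :=
  tlift (fun v a => phi a *: v) t.

HB.instance Definition _ (V : vectType C) (phi : G -> C) :=
  GRing.Linear.copy (@slice V phi) (tlift (fun (v : V) a => phi a *: v)).

Lemma slice_pure (V : vectType C) (phi : {scalar G}) (v : V) a :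
  slice phi (pure v a) = phi a *: v.
Proof.
by rewrite /slice tlift_pure //; apply: rslice_bilinear.
Qed.

Lemma slice_tmap (V W : vectType C) (phi : {scalar G}) (T : {linear V -> W})
    (t : tensor V G) :
  slice phi (tmap T id t) = T (slice phi t).
Proof.
rewrite /slice [RHS]linear_tlift tlift_tmap; last exact: rslice_bilinear.
by apply: eq_tlift => v a; rewrite linearZ.
Qed.

Lemma pure_tsub (V : vectType C) (U : {vspace V}) u (a : G) :
  u \in U -> pure u a \in tsub G U.
Proof.
move=> Uu; rewrite (coord_vbasis Uu) linear_sumlz memv_suml // => i _.
rewrite linearZl_LR memvZ //= (coord_vbasis (memvf a)) linear_sumr.
rewrite memv_suml // => j _; rewrite linearZr_LR memvZ //=.
by apply: memv_span; apply: allpairs_f; apply: mem_nth; rewrite size_tuple.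
Qed.

(** Slices turn membership in U (x) F(G) into membership in U, which makes
    invariance of kernels and images immediate. *)
Lemma tsubP (V : vectType C) (U : {vspace V}) (t : tensor V G) :
  (forall phi : {scalar G}, slice phi t \in U) <-> t \in tsub G U.
Proof.
split=> [slice_t | ].
  have [ip _] := @ntrace_dot R G; have [e oe] := orthonormal_basis_exists ip.
  rewrite (tensor_expandr oe t) memv_suml // => i _; apply: pure_tsub.
  exact: (slice_t (applyr ip (tnth e i))).
move=> Ut phi; have := memv_img (linfun (slice (V := V) phi)) Ut.
rewrite lfunE /=; apply/subvP; rewrite limg_span; apply/span_subvP => _ 
  /mapP[_ /allpairsP[[u a] /= [Uu _ ->]] ->].
by rewrite lfunE /= slice_pure memvZ // (vbasis_mem Uu).
Qed.

End Slices.

Section Representation.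
Variables (R : realType) (G : finite_quantum_group R).
Local Notation C := R[i].
Local Notation Delta := (comult G).
Local Notation eps := (counit G).

(** The coefficients are studied for bare comodules with an orthonormal basis:
    the unitarity of a subcomodule of F(G) is proved from these lemmas before it
    becomes a unitary representation. *)
Section Corepresentation.
Variables (V : vectType C) (ip : {dot V for conjC}) (basis : (\dim {:V}).-tuple V).
Variable kappa : {linear V -> tensor V G}.
Hypothesis oe : orthonormal ip basis.
Hypothesis kappaA : forall v,
  tassoc (tmap kappa id (kappa v)) = tmap id (comult G) (kappa v).
Hypothesis kappa_counit : forall v,
  tlift (fun w a => counit G a *: w) (kappa v) = v.
Local Notation e i := (tnth basis i).
Local Notation u i j := (matrix_coef ip basis kappa i j).

Lemma corep_basis j : kappa (e j) = \sum_i pure (e i) (u i j).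
Proof. exact: (tensor_expandl oe). Qed.

Lemma comult_coef i j : Delta (u i j) = \sum_k pure (u i k) (u k j).
Proof.
pose beta (v : V) (a b : G) := ip v (e i) *: pure a b.
have tri : trilinear beta.
  split=> [a b|v b|v a] c x y; rewrite /beta.
  - by rewrite linearPl /= scalerDl scalerA.
  - by rewrite (pure_bilinear G G).1 scalerDr scalerA mulrC -scalerA.
  - by rewrite (pure_bilinear G G).2 scalerDr scalerA mulrC -scalerA.
have [bv ba bb] := tri; have := tassoc_tlift tri (kappaA (e j)).
rewrite corep_basis.
rewrite (tlift_sum_pure (fun k => e k) (fun k => u k j)); last first.
  split=> [a|v] c x y.
    by rewrite linearP tlift_is_linear.
  exact: (@tlift_linear_arg C V G G _ (fun x v1 a1 => beta v1 a1 x) _ bb).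
rewrite (tlift_sum_pure (fun k => e k) (fun k => u k j)); last first.
  split=> [a|v] c x y; last by rewrite linearP tlift_is_linear.
  exact: (@tlift_linear_arg C G G V _ beta _ bv).
rewrite [RHS](bigD1 i) //= [X in _ = _ + X]big1 ?addr0 => [|k neq_ki]; last first.
  rewrite /beta /tlift big1 // => p _; rewrite big1 // => q _.
  by rewrite orthonormalE_tnth // (negPf neq_ki) scale0r scaler0.
under [X in _ = X -> _]eq_tlift => a b.
  rewrite /beta orthonormalE_tnth // eqxx scale1r.
  over.
rewrite tlift_id => <-; apply: eq_bigr => k _.
rewrite [u i k]/matrix_coef pure_tliftl; apply: eq_tlift => v a.
by rewrite pureZl.
Qed.

Lemma counit_coef i j : eps (u i j) = (i == j)%:R.
Proof.
have := kappa_counit (e j).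
rewrite -[tlift _ _]/(slice eps (kappa (e j))) corep_basis linear_sum /=.
under eq_bigr => k _ do rewrite slice_pure.
move/(congr1 (fun v => ip v (e i))).
rewrite linear_sumlz (bigD1 i) //= linearZl_LR /= orthonormalE_tnth // eqxx mulr1.
rewrite big1 ?addr0 => [->|k neq_ki].
  by rewrite orthonormalE_tnth // eq_sym.
by rewrite linearZl_LR /= orthonormalE_tnth // (negPf neq_ki) mulr0.
Qed.

End Corepresentation.

Section OneRepresentation.
Variable V : unitary_rep G.
Local Notation e i := (tnth (rep_basis V) i).
Local Notation u i j := (@rho R G V i j).

Lemma coaction_basis j : coaction V (e j) = \sum_i pure (e i) (u i j).
Proof. exact: corep_basis (rep_basis_orthonormal V) _. Qed.

Lemma comult_rho i j : Delta (u i j) = \sum_k pure (u i k) (u k j).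
Proof. exact: (comult_coef (rep_basis_orthonormal V) (@coactionA _ _ V)). Qed.

Lemma comult_star_rho i j :
  Delta (star (u i j)) = \sum_k pure (star (u i k)) (star (u k j)).
Proof. by rewrite comult_star comult_rho tstar_sum. Qed.

End OneRepresentation.

Lemma invariantP (V : unitary_rep G) (U : {vspace V}) :
  (forall (phi : {scalar G}) v, v \in U -> slice phi (coaction V v) \in U) ->
  invariant U.
Proof. by move=> inv_U v Uv; apply/tsubP => phi; apply: inv_U. Qed.

Definition intertwiner (V W : unitary_rep G) (T : {linear V -> W}) :=
  forall v, coaction W (T v) = tmap T id (coaction V v).

Lemma intertwiner_ker (V W : unitary_rep G) (T : {linear V -> W}) :
  intertwiner T -> invariant (lker (linfun T)).
Proof.
move=> tw; apply: invariantP => phi v; rewrite !memv_ker !lfunE /= => /eqP Tv.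
by rewrite -slice_tmap -tw Tv !linear0.
Qed.

Lemma intertwiner_img (V W : unitary_rep G) (T : {linear V -> W}) :
  intertwiner T -> invariant (limg (linfun T)).
Proof.
move=> tw; apply: invariantP => phi _ /memv_imgP[v _ ->].
by rewrite lfunE /= tw slice_tmap -[T _](lfunE T) memv_img ?memvf.
Qed.

Lemma schur_equivalent (V W : unitary_rep G) (T : {linear V -> W}) :
    irreducible_rep V -> irreducible_rep W -> intertwiner T ->
    (exists v, T v != 0) -> equivalent V W.
Proof.
move=> [_ irrV] [_ irrW] tw [v nzTv]; exists T; split=> //.
have ker0 : lker (linfun T) = 0%VS.
  case: (irrV _ (intertwiner_ker tw)) => // kerT; case/negP: nzTv.
  by have := memvf v; rewrite -kerT memv_ker lfunE.
have imgT : limg (linfun T) = fullv.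
  case: (irrW _ (intertwiner_img tw)) => // img0; case/negP: nzTv.
  by have := memv_img (linfun T) (memvf v); rewrite img0 memv0 lfunE.
exists (linfun T)^-1%VF => w.
  by rewrite -[T w](lfunE T) lker0_lfunK // ker0.
have := @limg_lfunVK _ _ _ (linfun T) w; rewrite imgT memvf => /(_ isT).
by rewrite lfunE.
Qed.

End Representation.

(** * Schur's lemma and the orthogonality relations *)
Section Orthogonality.
Variables (R : realType) (G : finite_quantum_group R).
Local Notation C := R[i].
Local Notation Delta := (comult G).
Local Notation h := (@ntrace R G).
Local Notation e V i := (tnth (rep_basis V) i).

Section Intertwiner.
Variables (V W : unitary_rep G).
Variable X : 'I_(\dim {:V}) -> 'I_(\dim {:W}) -> C.
Hypothesis X_commutes : forall p r,
  \sum_q X p q *: rho q r = \sum_m X m r *: @rho R G V p m.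

(** Matrices X with X u^W = u^V X are the intertwiners from W to V in the chosen
    orthonormal bases. *)
Lemma matrix_intertwiner : exists T : {linear W -> V},
  intertwiner T /\ forall q, T (e W q) = \sum_p X p q *: e V p.
Proof.
have oW := rep_basis_orthonormal W.
pose f w := \sum_q rep_ip W w (e W q) *: \sum_p X p q *: e V p.
have lin_f : linear f.
  move=> c x y; rewrite /f scaler_sumr -big_split.
  by apply: eq_bigr => q _; rewrite linearPl /= scalerDl scalerA.
pose F : {linear W -> V} :=
  HB.pack_for {linear W -> V} f (GRing.isLinear.Build C W V *:%R f lin_f).
have FE q : F (e W q) = \sum_p X p q *: e V p.
  rewrite /= /f (bigD1 q) //= orthonormalE_tnth // eqxx scale1r.
  rewrite [X in _ + X]big1 ?addr0 // => k neq_kq.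
  by rewrite orthonormalE_tnth // eq_sym (negPf neq_kq) scale0r.
suff tw (T : {linear W -> V}) :
    (forall q, T (e W q) = \sum_p X p q *: e V p) -> intertwiner T.
  by exists F; split=> //; apply: tw.
move=> TE w.
rewrite [w](orthonormal_expand oW) !linear_sum; apply: eq_bigr => r _.
rewrite !linearZ_LR; congr (_ *: _).
rewrite TE linear_sum coaction_basis linear_sum.
transitivity (\sum_p \sum_m X m r *: pure (e V p) (@rho R G V p m)).
  rewrite exchange_big; apply: eq_bigr => m _; rewrite linearZ_LR coaction_basis.
  by rewrite scaler_sumr.
transitivity (\sum_p \sum_q X p q *: pure (e V p) (@rho R G W q r)).
  apply: eq_bigr => p _.
  have := congr1 (pure (e V p)) (X_commutes p r); rewrite !linear_sumr /= => eqX.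
  under eq_bigr => m _ do rewrite -pureZr.
  by rewrite -eqX; apply: eq_bigr => q _; rewrite pureZr.
rewrite exchange_big; apply: eq_bigr => q _.
rewrite /= (tmap_pure T idfun).
by rewrite TE linear_sumlz; apply: eq_bigr => p _; rewrite /= pureZl.
Qed.

Lemma matrix_column_neq0 p q : X p q != 0 -> \sum_k X k q *: e V k != 0.
Proof.
move=> nzX; apply: contra nzX => /eqP T0; apply/eqP.
have := congr1 (fun v => rep_ip V v (e V p)) T0.
have oV := rep_basis_orthonormal V.
rewrite linear0l linear_sumlz (bigD1 p) //= linearZl_LR /=.
rewrite orthonormalE_tnth // eqxx mulr1 big1 ?addr0 // => k neq_kp.
by rewrite linearZl_LR /= orthonormalE_tnth // (negPf neq_kp) mulr0.
Qed.

End Intertwiner.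

(** Put X_mn = h (star u_im * w_jn) for the coefficient matrices u of V and w of
    W.  Left invariance of h reads X = u^* X w, and multiplying by the unitary
    matrix u gives u X = X w. *)
Lemma coef_pairing_commutes (V W : unitary_rep G) i j l r :
  \sum_q h (star (@rho R G V i l) * @rho R G W j q) *: @rho R G W q r =
  \sum_m h (star (@rho R G V i m) * @rho R G W j r) *: @rho R G V l m.
Proof.
pose X m n := h (star (@rho R G V i m) * @rho R G W j n).
have inv p q : X p q *: 1 =
    \sum_m \sum_n X m n *: (star (@rho R G V m p) * @rho R G W n q).
  rewrite -ntrace_left_invariant comultM comult_star_rho comult_rho tmul_sum.
  rewrite linear_sum; apply: eq_bigr => m _; rewrite /= tlift_sum_pure //.
  exact: slice_bilinear.
transitivity (\sum_p @rho R G V l p * (X p r *: 1)); last first.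
  by apply: eq_bigr => p _; rewrite -scalerAr mulr1.
under [RHS]eq_bigr => p _ do rewrite inv mulr_sumr.
rewrite exchange_big (bigD1 l) //= [X in _ = _ + X]big1 ?addr0 => [|m neq_ml].
  under [RHS]eq_bigr => p _ do rewrite mulr_sumr.
  rewrite exchange_big; apply: eq_bigr => n _ /=.
  under eq_bigr => p _ do rewrite -scalerAr mulrA.
  by rewrite -scaler_sumr -mulr_suml rep_unitary_right eqxx mul1r.
under eq_bigr => p _ do rewrite mulr_sumr.
rewrite exchange_big big1 // => n _ /=.
under eq_bigr => p _ do rewrite -scalerAr mulrA.
rewrite -scaler_sumr -mulr_suml rep_unitary_right eq_sym (negPf neq_ml).
by rewrite mul0r scaler0.
Qed.

Lemma coef_orthogonal (V W : unitary_rep G) i p j q :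
    irreducible_rep V -> irreducible_rep W -> ~ equivalent W V ->
  h (star (@rho R G V i p) * @rho R G W j q) = 0.
Proof.
move=> irrV irrW neqWV; apply/eqP/negP => /negP nzX; case: neqWV.
have com := @coef_pairing_commutes V W i j.
have [T [twT TE]] := matrix_intertwiner com.
apply: (schur_equivalent irrW irrV twT).
exists (e W q); rewrite TE.
exact: (@matrix_column_neq0 V W (fun m n => h (star (rho i m) * rho j n)) p q).
Qed.

(** A left eigenvector v of X for the eigenvalue a defines a functional killing
    the image of the intertwiner of X - a.  That image is therefore not the whole
    space, and irreducibility makes it zero. *)
Lemma schur_scalar (V : unitary_rep G) (X : 'I_(\dim {:V}) -> 'I_(\dim {:V}) -> C) :
    irreducible_rep V ->
    (forall p r, \sum_q X p q *: rho q r = \sum_m X m r *: @rho R G V p m) ->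
  exists a, forall p q, X p q = a *+ (p == q).
Proof.
move=> [dim_gt0 irrV] com.
pose M : 'M[C]_(\dim {:V}) := \matrix_(p, q) X p q.
have [a /eigenvalueP[v vM nz_v]] : exists a, eigenvalue M a.
  have [|a ra] := @closed_rootP C (char_poly M) _.
    by rewrite size_char_poly eqSS -lt0n.
  by exists a; rewrite eigenvalue_root_char.
pose Y p q := X p q - a *+ (p == q).
have comY p r : \sum_q Y p q *: rho q r = \sum_m Y m r *: @rho R G V p m.
  rewrite /Y; under eq_bigr => q _ do rewrite scalerBl.
  under [RHS]eq_bigr => q _ do rewrite scalerBl.
  rewrite !big_split com !sumrN; congr (_ - _).
  rewrite (bigD1 p) //= [RHS](bigD1 r) //= !eqxx !big1 // => k neq.
    by rewrite (negPf neq) scale0r.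
  by rewrite eq_sym (negPf neq) scale0r.
have [T [tw TE]] := matrix_intertwiner comY.
have oV := rep_basis_orthonormal V.
exists a => p q; apply/eqP; rewrite -subr_eq0 -[_ - _]/(Y p q); apply/negP => /negP nzY.
case: (irrV _ (intertwiner_img tw)) => [img0 | imgV].
  case/negP: (matrix_column_neq0 nzY); rewrite -TE.
  by have := memv_img (linfun T) (memvf (e V q)); rewrite img0 memv0 lfunE.
case/negP: nz_v; apply/eqP/rowP => k; rewrite mxE.
pose phi w := \sum_i v 0 i * rep_ip V w (e V i).
have phiT w : phi (T w) = 0.
  rewrite [w](orthonormal_expand oV) linear_sum /phi.
  under eq_bigr => i _ do rewrite linear_sumlz mulr_sumr.
  rewrite exchange_big big1 // => r _ /=.
  under eq_bigr => i _ do rewrite linearZ_LR linearZl_LR /= mulrCA.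
  rewrite -mulr_sumr TE.
  under eq_bigr => i _.
    rewrite linear_sumlz (bigD1 i) //= linearZl_LR /= orthonormalE_tnth // eqxx mulr1.
    rewrite big1 ?addr0 => [|l neq_li]; last first.
      by rewrite linearZl_LR /= orthonormalE_tnth // (negPf neq_li) mulr0.
    rewrite /Y mulrBr.
    over.
  have diag : \sum_i v 0 i * (a *+ (i == r)) = a * v 0 r.
    rewrite (bigD1 r) //= eqxx mulr1n [v 0 r * a]mulrC big1 ?addr0 // => i neq_ir.
    by rewrite (negPf neq_ir) mulr0.
  have /rowP/(_ r) := vM; rewrite !mxE big_split sumrN /= diag => <-.
  under [X in _ - X]eq_bigr => i _ do rewrite mxE.
  by rewrite subrr mulr0.
have /memv_imgP[w _] : e V k \in limg (linfun T) by rewrite imgV memvf.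
rewrite lfunE /= => ek; have := phiT w; rewrite -ek /phi (bigD1 k) //=.
rewrite orthonormalE_tnth // eqxx mulr1 big1 ?addr0 // => i neq_ik.
by rewrite orthonormalE_tnth // eq_sym (negPf neq_ik) mulr0.
Qed.

(** The pairing matrix is a scalar a by Schur's lemma.  Its trace is a d, and
    since h is tracial it is also h of the sum of the u_jk * star u_ik, which
    unitarity identifies with h of the scalar [i = j]. *)
Lemma schur_orthogonality (V : unitary_rep G) i p j q : irreducible_rep V ->
  h (star (@rho R G V i p) * @rho R G V j q) =
  ((i == j) && (p == q))%:R / (rep_dim V)%:R.
Proof.
move=> irrV; have [a Xa] := schur_scalar irrV (@coef_pairing_commutes V V i j).
have dim_neq0 : (rep_dim V)%:R != 0 :> C by rewrite pnatr_eq0 -lt0n; case: irrV.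
suff aE : a = (i == j)%:R / (rep_dim V)%:R.
  by rewrite Xa aE; case: (i == j); case: (p == q); rewrite ?mul0r ?mul0rn.
apply: (mulIf dim_neq0); rewrite divfK // mulr_natr.
transitivity (\sum_k h (star (@rho R G V i k) * @rho R G V j k)).
  under eq_bigr => k _ do rewrite Xa eqxx.
  by rewrite sumr_const card_ord.
under eq_bigr => k _ do rewrite ntraceM.
rewrite -(linear_sum h) /= rep_unitary_right eq_sym.
by case: (i == j); rewrite ?(@ntrace_state R G).1 ?(linear0 h).
Qed.

End Orthogonality.

(** * Subcomodules of F(G) are unitary representations *)
Section Subrepresentation.
Variables (R : realType) (G : finite_quantum_group R).
Local Notation C := R[i].
Local Notation Delta := (comult G).
Local Notation eps := (counit G).
Local Notation h := (@ntrace R G).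

Lemma tmap_comp (U V U' V' U'' V'' : vectType C)
    (f : {linear U -> U'}) (g : {linear V -> V'})
    (f' : {linear U' -> U''}) (g' : {linear V' -> V''}) (t : tensor U V) :
  tmap f' g' (tmap f g t) = tmap (f' \o f) (g' \o g) t.
Proof.
rewrite {1}/tmap tlift_tmap //; split=> [v|u] c x y /=.
  by rewrite linearP (pure_bilinear _ _).1.
by rewrite linearP (pure_bilinear _ _).2.
Qed.

Lemma tassoc_tmap (U U' V W : vectType C) (f : {linear U -> U'})
    (T : tensor (tensor U V) W) :
  tassoc (tmap (tmap f (@idfun V)) (@idfun W) T) = tmap f idfun (tassoc T).
Proof.
rewrite /tassoc tlift_tmap; last first.
  split=> [w|s] c x y; first by rewrite tlift_is_linear.
  apply: (@tlift_linear_arg _ _ _ _ _ (fun w u v => pure u (pure v w))).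
  move=> u v c' x' y'.
  by rewrite (pure_bilinear V W).2 (pure_bilinear U' (tensor V W)).2.
rewrite [RHS]linear_tlift; apply: eq_tlift => s w /=.
rewrite tlift_tmap; last first.
  split=> [v|u] c x y; first by rewrite (pure_bilinear U' (tensor V W)).1.
  by rewrite (pure_bilinear V W).1 (pure_bilinear U' (tensor V W)).2.
rewrite [RHS]linear_tlift; apply: eq_tlift => u v /=.
by rewrite (tmap_pure f idfun).
Qed.

(** Identities in V (x) F(G) may be checked on slices, where the inclusion and the
    projection of a subcomodule cancel. *)
Lemma slice_inj (V : vectType C) (s t : tensor V G) :
  (forall phi : {scalar G}, slice phi s = slice phi t) -> s = t.
Proof.
move=> eq_st; have [ip _] := @ntrace_dot R G.
have [e oe] := orthonormal_basis_exists ip.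
rewrite (tensor_expandr oe s) (tensor_expandr oe t); apply: eq_bigr => i _.
by congr pure; apply: (eq_st (applyr ip (tnth e i))).
Qed.

Definition coinvariant (U : {vspace G}) :=
  forall (phi : {scalar G}) a, a \in U -> slice phi (Delta a) \in U.

Section Restriction.
Variable U : {vspace G}.
Hypothesis inv_U : coinvariant U.

Let inc : {linear subvs_of U -> G} := vsval.
Let pi : {linear G -> subvs_of U} := vsproj U.
Let restriction : {linear subvs_of U -> tensor (subvs_of U) G} :=
  tmap pi idfun \o (Delta \o inc).

Lemma inc_restriction v : tmap inc idfun (restriction v) = Delta (inc v).
Proof.
apply: slice_inj => phi; rewrite !slice_tmap.
by rewrite [LHS]vsprojK // inv_U // subvsP.
Qed.

Lemma restrictionA v :
  tassoc (tmap restriction id (restriction v)) = tmap id Delta (restriction v).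
Proof.
have -> : tmap restriction id (restriction v) =
    tmap (tmap pi idfun) idfun (tmap Delta idfun (Delta (inc v))).
  rewrite -(inc_restriction v) (tmap_comp inc idfun Delta idfun).
  by rewrite (tmap_comp (Delta \o inc) idfun (tmap pi idfun) idfun).
rewrite tassoc_tmap -[tmap Delta idfun _]/(tmap Delta id _) comultA.
rewrite (tmap_comp idfun Delta pi idfun) /=.
by rewrite -[RHS]/(tmap idfun Delta (tmap pi idfun (Delta (inc v)))) tmap_comp.
Qed.

Lemma restriction_counit v : tlift (fun w a => eps a *: w) (restriction v) = v.
Proof.
rewrite -[LHS]/(slice eps (tmap pi idfun (Delta (inc v)))) slice_tmap.
by rewrite /slice counit_right; apply: vsvalK.
Qed.

(** Applying h (x) id to Delta(star w_i * w_j) for an orthonormal basis w of U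
    shows that the coefficient matrix is an isometry; the antipode supplies a
    right inverse, so it is unitary. *)
Lemma subrep_exists : exists (V : unitary_rep G) (J : {linear V -> G}),
  [/\ injective J, limg (linfun J) = U
    & forall v, Delta (J v) = tmap J idfun (coaction V v)].
Proof.
have [ipG ipGE] := @ntrace_dot R G.
pose f (x y : subvs_of U) : C := ipG (inc x) (inc y).
have bil_f : bilinear_for *%R (conjC \; *%R) f.
  split=> [y|x] c a b; rewrite /f (linearP inc); first by rewrite linearPl.
  by rewrite linearPr.
have herm_f x y : f x y = (-1) ^+ false * conjC (f y x) by rewrite /f hermC.
have pos_f x : x != 0 -> 0 < f x x.
  by move=> nzx; rewrite /f dnorm_gt0; apply: contra nzx => /eqP x0; apply/eqP/subvs_inj.
pose ip : {dot subvs_of U for conjC} :=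
  HB.pack_for {dot subvs_of U for conjC} f
    (bilinear_isBilinear.Build C _ _ C *%R (conjC \; *%R) f bil_f)
    (isHermitianSesquilinear.Build C _ false conjC f herm_f)
    (isDotProduct.Build C _ f pos_f).
have ipE x y : ip x y = h (star (inc y) * inc x) by rewrite -ipGE.
have [e oe] := orthonormal_basis_exists ip.
pose u i j := matrix_coef ip e restriction i j.
have Delta_basis j : Delta (inc (tnth e j)) = \sum_i pure (inc (tnth e i)) (u i j).
  rewrite -inc_restriction (corep_basis restriction oe) linear_sum; apply: eq_bigr => i _.
  by rewrite /= (tmap_pure inc idfun).
have u_left i j : \sum_k star (u k i) * u k j = (i == j)%:R.
  have := ntrace_left_invariant (star (inc (tnth e i)) * inc (tnth e j)).
  rewrite -ipE orthonormalE_tnth // comultM comult_star !Delta_basis tstar_sum tmul_sum.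
  rewrite linear_sum eq_sym scaler_nat => <-; apply: eq_bigr => k _ /=.
  rewrite tlift_sum_pure; last exact: slice_bilinear.
  rewrite (bigD1 k) //= -ipE orthonormalE_tnth // eqxx scale1r big1 ?addr0 // => l.
  by rewrite -ipE orthonormalE_tnth // => /negPf ->; rewrite scale0r.
have u_right i j : \sum_k u i k * star (u j k) = (i == j)%:R.
  pose M : 'M[G]_(\dim {:subvs_of U}) := \matrix_(i, j) u i j.
  pose Mstar : 'M[G]_(\dim {:subvs_of U}) := \matrix_(i, j) star (u j i).
  pose MS : 'M[G]_(\dim {:subvs_of U}) := \matrix_(i, j) antipode G (u i j).
  have MstarM : Mstar *m M = 1%:M.
    apply/matrixP=> k l; rewrite !mxE -u_left.
    by apply: eq_bigr => m _; rewrite !mxE.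
  have MMS : M *m MS = 1%:M.
    apply/matrixP=> k l; rewrite !mxE.
    rewrite -[RHS]scaler_nat -(counit_coef oe restriction_counit) -antipode_right.
    rewrite (comult_coef oe restrictionA).
    rewrite tlift_sum_pure; first by apply: eq_bigr => m _; rewrite !mxE.
    split=> [w|w] c x y; rewrite ?linearP; first by rewrite mulrDl -scalerAl.
    by rewrite mulrDr -scalerAr.
  have MSE : MS = Mstar by rewrite -[MS]mul1mx -MstarM -mulmxA MMS mulmx1.
  have := congr1 (fun N : 'M_ _ => N i j) MMS; rewrite MSE !mxE => <-.
  by apply: eq_bigr => k _; rewrite !mxE.
pose V : unitary_rep G := UnitaryRep oe restrictionA restriction_counit u_left u_right.
exists V, inc; split=> [||v]; first exact: subvs_inj.
  apply/vspaceP => a; apply/memv_imgP/idP => [[v _ ->]|Ua].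
    by rewrite lfunE subvsP.
  by exists (pi a); rewrite ?memvf // lfunE; rewrite /= vsprojK.
exact: esym (inc_restriction v).
Qed.

End Restriction.
End Subrepresentation.

(** * The Peter-Weyl theorem *)
Section PeterWeyl.
Variables (R : realType) (G : finite_quantum_group R).
Local Notation C := R[i].
Local Notation Delta := (comult G).
Local Notation eps := (counit G).
Local Notation h := (@ntrace R G).

Definition coef_space (V : unitary_rep G) : {vspace G} :=
  (\sum_i \sum_j <[@rho R G V i j]>)%VS.

Lemma rho_coef_space (V : unitary_rep G) i j : @rho R G V i j \in coef_space V.
Proof.
rewrite memvE (subv_trans _ (sumv_sup i _ (subvv _))) //.
exact: (sumv_sup j).
Qed.

Lemma coef_spaceP (V : unitary_rep G) (phi : {scalar V}) v :
  tlift (fun w a => phi w *: a) (coaction V v) \in coef_space V.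
Proof.
rewrite [v](orthonormal_expand (rep_basis_orthonormal V)) !linear_sum memv_suml // => j _.
rewrite !linearZ memvZ //= coaction_basis tlift_sum_pure; last exact: slice_bilinear.
by rewrite memv_suml // => i _; rewrite memvZ ?rho_coef_space.
Qed.

Lemma coef_space_equivalent (V W : unitary_rep G) :
  equivalent V W -> (coef_space V <= coef_space W)%VS.
Proof.
case=> T [bijT tw]; apply/subv_sumP => i _; apply/subv_sumP => j _.
have ker0 : lker (linfun T) == 0%VS.
  by apply/lker0P => x y; rewrite !lfunE; apply: (bij_inj bijT).
pose psi : {scalar W} := applyr (rep_ip V) (tnth (rep_basis V) i) \o (linfun T)^-1%VF.
rewrite -memvE.
suff -> : @rho R G V i j =
    tlift (fun w a => psi w *: a) (coaction W (T (tnth (rep_basis V) j))).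
  exact: coef_spaceP.
rewrite tw tlift_tmap; last exact: slice_bilinear.
apply: eq_tlift => v a; congr (_ *: _).
by rewrite /= -[T v](lfunE T) lker0_lfunK.
Qed.

(** The complement of a row of coefficients is a subcomodule.  Put
    b_k = (h (star u_ik .) (x) id) Delta(a).  Left invariance applied to
    star u_ij * a gives that the sum over k of star u_kj b_k vanishes for every j,
    and the unitarity of u yields b = 0. *)
Lemma coef_space_orthogonal (V : unitary_rep G) (phi : {scalar G}) a i l :
    (forall j, h (star (@rho R G V i j) * a) = 0) ->
  h (star (@rho R G V i l) * slice phi (Delta a)) = 0.
Proof.
move=> orth_a; have [ip _] := @ntrace_dot R G.
have [e oe] := orthonormal_basis_exists ip.
pose z m := tlift (fun w v => ip v (tnth e m) *: w) (Delta a).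
have Da : Delta a = \sum_m pure (z m) (tnth e m) := tensor_expandr oe _.
pose b k := \sum_m h (star (@rho R G V i k) * z m) *: tnth e m.
have sum0 j : \sum_k star (@rho R G V k j) * b k = 0.
  have := ntrace_left_invariant (star (@rho R G V i j) * a).
  rewrite orth_a scale0r comultM comult_star_rho Da tmul_sum linear_sum => sum_eq0.
  rewrite -[RHS]sum_eq0.
  apply: eq_bigr => k _; rewrite /= tlift_sum_pure; last exact: slice_bilinear.
  by rewrite mulr_sumr; apply: eq_bigr => m _; rewrite -scalerAr.
have bl0 : b l = 0.
  transitivity (\sum_j @rho R G V l j * (\sum_k star (@rho R G V k j) * b k)).
    under [RHS]eq_bigr => j _ do rewrite mulr_sumr.
    rewrite exchange_big (bigD1 l) //= [X in _ = _ + X]big1 => [|k neq_kl].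
      under [X in _ = X + _]eq_bigr => j _ do rewrite mulrA.
      by rewrite -mulr_suml rep_unitary_right eqxx mul1r addr0.
    under eq_bigr => j _ do rewrite mulrA.
    by rewrite -mulr_suml rep_unitary_right eq_sym (negPf neq_kl) mul0r.
  by rewrite big1 // => j _; rewrite sum0 mulr0.
rewrite -[RHS](linear0 phi) -bl0 linear_sum Da linear_sum mulr_sumr linear_sum.
by apply: eq_bigr => m _; rewrite /= slice_pure -scalerAr !scalarZ mulrC.
Qed.

Lemma coinvariant_minimal (U : {vspace G}) :
    U != 0%VS -> coinvariant U ->
  exists M : {vspace G}, [/\ M != 0%VS, coinvariant M, (M <= U)%VS &
    forall N : {vspace G}, (N <= M)%VS -> coinvariant N -> N = 0%VS \/ N = M].
Proof.
move: {2}(\dim U).+1 (ltnSn (\dim U)) => n; elim: n U => // n IHn U ltUn nzU invU.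
have [[N [nzN sNU neqNU invN]]|minU] := pselect (exists N : {vspace G},
    [/\ N != 0%VS, (N <= U)%VS, N <> U & coinvariant N]).
  have ltN : (\dim N < n)%N.
    apply: leq_trans (ltUn : _ <= n)%N; rewrite ltn_neqAle dimvS // andbT.
    by rewrite dimv_leqif_eq //; apply/eqP.
  have [M [nzM invM sMN minM]] := IHn N ltN nzN invN.
  by exists M; split=> //; apply: subv_trans sMN sNU.
exists U; split=> // N sNU invN.
have [->|nzN] := eqVneq N 0%VS; [by left | right].
by have [//|neqNU] := pselect (N = U); case: minU; exists N.
Qed.

(** The counit recovers an element of a subcomodule of F(G) from its
    coefficients. *)
Lemma subrep_coef_space (V : unitary_rep G) (J : {linear V -> G}) :
    (forall v, Delta (J v) = tmap J idfun (coaction V v)) ->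
  (limg (linfun J) <= coef_space V)%VS.
Proof.
move=> tw; apply/subvP => _ /memv_imgP[v _ ->]; rewrite lfunE /=.
rewrite -(counit_left (J v)) tw tlift_tmap; last exact: slice_bilinear.
exact: (coef_spaceP (eps \o J)).
Qed.

Theorem peter_weyl (Irr : finType) (kappa : Irr -> unitary_rep G) :
  complete_irr kappa -> (\sum_alpha coef_space (kappa alpha))%VS = fullv.
Proof.
case=> _ _ complete; set W := (\sum_alpha _)%VS.
apply/eqP/negP => /negP properW.
have [ip ipE] := @ntrace_dot R G.
have coefW alpha : (coef_space (kappa alpha) <= W)%VS by apply: (sumv_sup alpha).
pose O := orthov ip W.
have nzO : O != 0%VS.
  have [v nzv ov] := orthogonal_neq0 ip properW.
  apply: contra nzv => /eqP O0; rewrite -memv0 -O0; exact/mem_orthovP.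
have invO : coinvariant O.
  move=> phi a /mem_orthovP Oa; apply/mem_orthovP => w.
  case/memv_sumP=> ws memws ->; rewrite linear_sumr big1 // => alpha _.
  have /memv_sumP[ws1 memws1 ->] := memws alpha isT.
  rewrite linear_sumr big1 // => i _.
  have /memv_sumP[ws2 memws2 ->] := memws1 i isT.
  rewrite linear_sumr big1 // => l _.
  have /vlineP[c ->] := memws2 l isT.
  rewrite linearZr_LR /= ipE coef_space_orthogonal ?mulr0 // => j.
  by rewrite -ipE Oa // (subvP (coefW alpha)) // rho_coef_space.
have [M [nzM invM sMO minM]] := coinvariant_minimal nzO invO.
have [V [J [injJ imgJ tw]]] := subrep_exists invM.
have kerJ : lker (linfun J) == 0%VS by apply/lker0P => x y; rewrite !lfunE; apply: injJ.
have irrV : irreducible_rep V.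
  split=> [|U invU].
    rewrite lt0n dimv_eq0; apply: contra nzM => /eqP V0.
    by rewrite -imgJ V0 limg0.
  have invJU : coinvariant (linfun J @: U)%VS.
    move=> phi _ /memv_imgP[v Uv ->]; rewrite lfunE /= tw slice_tmap -[J _](lfunE J).
    by rewrite memv_img //; have /tsubP := invU v Uv; apply.
  have sJU : (linfun J @: U <= M)%VS by rewrite -imgJ limgS // subvf.
  case: (minM _ sJU invJU) => [JU0 | JUM]; [left | right].
    apply/eqP; rewrite -(eq_limg_ker0 _ _ kerJ) JU0 limg0 //.
  by apply/eqP; rewrite -(eq_limg_ker0 _ _ kerJ) JUM imgJ.
have [alpha eqV] := complete V irrV.
have sMW : (M <= W)%VS.
  rewrite -imgJ; apply: subv_trans (subrep_coef_space tw) _.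
  exact: subv_trans (coef_space_equivalent eqV) (coefW alpha).
case/negP: nzM; rewrite -vpick0 -(dnorm_eq0 ip).
have Mv := memv_pick M.
have /mem_orthovP -> // := subvP sMO _ Mv.
exact: subvP sMW _ Mv.
Qed.

End PeterWeyl.

(** * Convolution powers of a central state *)
Section RandomWalk.
Local Open Scope classical_set_scope.
Local Open Scope ring_scope.
Local Open Scope complex_scope.
Variables (R : realType) (G : finite_quantum_group R).
Local Notation C := R[i].
Local Notation Delta := (comult G).
Local Notation h := (@ntrace R G).

(** Invariance makes row k of the matrix h(u) a functional phi on V with
    (phi (x) id) coaction = phi 1.  Its kernel is invariant; if phi is nonzero,
    irreducibility makes the kernel zero, so V is one-dimensional and u = 1. *)
Lemma ntrace_rho_nontrivial (V : unitary_rep G) k l :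
  irreducible_rep V -> ~ trivial_rep V -> h (@rho R G V k l) = 0.
Proof.
move=> [dim_gt0 irrV] nontriv; apply/eqP/negP => /negP nz_hkl; apply: nontriv.
have oV := rep_basis_orthonormal V.
pose f v := \sum_m h (@rho R G V k m) * rep_ip V v (tnth (rep_basis V) m).
have lin_f : scalar f.
  move=> c x y; rewrite /f mulr_sumr -big_split; apply: eq_bigr => m _ /=.
  by rewrite linearPl /= mulrDr mulrCA.
have [phi phiE] : exists phi : {scalar V}, phi =1 f.
  by exists (HB.pack_for {scalar V} f (GRing.isLinear.Build C V C *%R f lin_f)).
have phi_basis m : phi (tnth (rep_basis V) m) = h (@rho R G V k m).
  rewrite phiE /f (bigD1 m) //= orthonormalE_tnth // eqxx mulr1 big1 ?addr0 // => p neq_pm.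
  by rewrite orthonormalE_tnth // eq_sym (negPf neq_pm) mulr0.
have row_inv j : \sum_m h (@rho R G V k m) *: @rho R G V m j = h (@rho R G V k j) *: 1.
  rewrite -ntrace_left_invariant comult_rho tlift_sum_pure //; exact: slice_bilinear.
have phi_inv v : tlift (fun w a => phi w *: a) (coaction V v) = phi v *: 1.
  rewrite [v](orthonormal_expand oV) !linear_sum scaler_suml; apply: eq_bigr => j _.
  rewrite !linearZ_LR /= -scalerA; congr (_ *: _).
  rewrite coaction_basis tlift_sum_pure; last exact: slice_bilinear.
  by rewrite phi_basis -row_inv; apply: eq_bigr => m _; rewrite phi_basis.
pose L : {linear V -> C^o} := phi.
have ker_inv : invariant (lker (linfun L)).
  apply: invariantP => psi v; rewrite !memv_ker !lfunE /= => /eqP phi_v.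
  apply/eqP; transitivity (psi (tlift (fun w a => phi w *: a) (coaction V v))).
    rewrite /slice !(linear_for_tlift (W' := C^o)) => [|c x y|c x y]; rewrite ?linearP //.
    by apply: eq_tlift => w a; rewrite !scalarZ mulrC.
  by rewrite phi_inv /= phi_v scale0r linear0.
have ker0 : lker (linfun L) = 0%VS.
  case: (irrV _ ker_inv) => // kerT; case/negP: nz_hkl.
  have : tnth (rep_basis V) l \in lker (linfun L) by rewrite kerT memvf.
  by rewrite memv_ker lfunE -phi_basis.
have dim1 : \dim {:V} = 1%N.
  apply/eqP; rewrite eqn_leq [(0 < _)%N]dim_gt0 andbT.
  have := limg_ker_dim (linfun L) fullv; rewrite ker0 capv0 dimv0 add0n => <-.
  by apply: leq_trans (dimvS (subvf _)) _; rewrite dimvf.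
split=> // i j.
have all_eq (p q : 'I_(\dim {:V})) : p = q.
  apply/val_inj; case: p q => p ltp [q ltq] /=; move: ltp ltq.
  by rewrite dim1 !ltnS !leqn0 => /eqP -> /eqP ->.
have := row_inv l; rewrite (bigD1 l) //= big1 ?addr0 => [|m]; last first.
  by rewrite (all_eq m l) eqxx.
rewrite (all_eq i l) (all_eq j l); exact: (scalerI nz_hkl).
Qed.

(** Linear induction over the adjoints of the coefficients, which span F(G). *)
Lemma star_rho_ind (Irr : finType) (kappa : Irr -> unitary_rep G) (P : G -> Prop) :
    complete_irr kappa -> P 0 -> (forall x y, P x -> P y -> P (x + y)) ->
    (forall (c : C) x, P x -> P (c *: x)) ->
    (forall alpha i j, P (star (@rho R G (kappa alpha) i j))) ->
  forall a, P a.
Proof.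
move=> kappa_irr P0 PD PZ Prho a.
have P_sum (I : finType) (b : I -> G) :
    (forall i, P (star (b i))) -> P (star (\sum_i b i)).
  by move=> Pb; rewrite star_sum; apply: (big_ind P).
rewrite -[a]starK; have : star a \in (\sum_alpha coef_space (kappa alpha))%VS.
  by rewrite (peter_weyl kappa_irr) memvf.
case/memv_sumP=> ws memws ->; apply: (P_sum) => alpha.
have /memv_sumP[ws1 memws1 ->] := memws alpha isT; apply: (P_sum) => i.
have /memv_sumP[ws2 memws2 ->] := memws1 i isT; apply: (P_sum) => j.
by have /vlineP[c ->] := memws2 j isT; rewrite starZ; apply: PZ.
Qed.

Section CentralWalk.
Variables (Irr : finType) (kappa : Irr -> unitary_rep G).
Hypothesis kappa_irr : complete_irr kappa.
Variables (nu : {scalar G}) (f : Irr -> C).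
Hypothesis nu1 : nu 1 = 1.
Hypothesis density : forall g,
  nu g = h ((\sum_alpha f alpha *: character (kappa alpha)) * g).
Local Notation u alpha i j := (@rho R G (kappa alpha) i j).
Local Notation d alpha := (rep_dim (kappa alpha)).

(** Once the trace property has moved star u_ij to the left of the characters,
    the orthogonality relations kill every term but the one of u_ii, which they
    evaluate to [i = j] / d_alpha. *)
Lemma central_state_rho alpha i j :
  nu (star (u alpha i j)) = f alpha / (d alpha)%:R *+ (i == j).
Proof.
have [irr uniq _] := kappa_irr.
rewrite density mulr_suml linear_sum (bigD1 alpha) //=.
rewrite [X in _ + X]big1 ?addr0 => [|beta neq].
  rewrite -scalerAl scalarZ /= ntraceM /character mulr_sumr linear_sum (bigD1 i) //=.
  rewrite schur_orthogonality // eqxx /= big1 ?addr0 => [|k neq_ki].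
    by rewrite eq_sym; case: eqP; rewrite ?mul1r ?mul0r ?mulr0.
  by rewrite schur_orthogonality // eq_sym (negPf neq_ki) mul0r.
rewrite -scalerAl scalarZ /= ntraceM /character mulr_sumr linear_sum.
rewrite big1 ?mulr0 // => k _ /=.
rewrite coef_orthogonal // => /uniq eq_ba; by rewrite eq_ba eqxx in neq.
Qed.

(** The exponent is k for positive k; the convolution power of index 0 is nu
    itself. *)
Lemma conv_pow_rho alpha k i j :
  conv_pow nu k (star (u alpha i j)) =
  (f alpha / (d alpha)%:R) ^+ k.-1.+1 *+ (i == j).
Proof.
rewrite /conv_pow; elim: k.-1 i => [|n IHn] i; first by rewrite /= central_state_rho.
rewrite iterS /= /conv_fun comult_star_rho tlift_sum_pure; last exact: scalar_bilinear.
rewrite (bigD1 i) //= big1 ?addr0 => [|m neq_mi].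
  by rewrite central_state_rho eqxx mulr1n IHn mulrnAr -exprS.
by rewrite central_state_rho eq_sym (negPf neq_mi) mulr0n mul0r.
Qed.

Lemma rep_dim_gt0 alpha : 0 < (d alpha)%:R :> C.
Proof. by rewrite ltr0n; have [irr _ _] := kappa_irr; case: (irr alpha). Qed.

Lemma cvg_exprn (z : C) : `|z| < 1 ->
  (fun k => z ^+ k.-1.+1 : (C : numFieldType)) @ \oo --> (0 : (C : numFieldType)).
Proof.
move=> z_lt1; apply/cvgrPdist_lt => eps eps_gt0.
pose r := complex.Re `|z|; pose e := complex.Re eps.
have rE : r%:C = `|z| by rewrite /r RRe_real // normr_real.
have eE : e%:C = eps by rewrite /e RRe_real // gtr0_real.
have e_gt0 : 0 < e by rewrite -ltcR eE.
have r_ge0 : 0 <= r by rewrite -ler0c rE.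
have r_lt1 : `|r| < 1 by rewrite ger0_norm // -ltcR rE.
have /cvgrPdist_lt /(_ e e_gt0) := cvg_expr r_lt1.
case=> N _ small; exists N.+1 => // k /= ltNk.
have k_gt0 : (0 < k)%N by apply: leq_trans ltNk.
rewrite prednK // sub0r normrN normrX -rE -eE -rmorphXn ltcR.
by have := small k (ltnW ltNk); rewrite sub0r normrN ger0_norm // exprn_ge0.
Qed.

Lemma ergodic_central (h0 : {scalar G}) : h0 =1 h ->
  ergodic h0 nu <-> forall alpha, ~ trivial_rep (kappa alpha) ->
    `|f alpha| < (d alpha)%:R.
Proof.
move=> h0E; have [irr _ _] := kappa_irr.
have [h1 h_ge0] := @ntrace_state R G.
have h_star_rho alpha i j : ~ trivial_rep (kappa alpha) -> h (star (u alpha i j)) = 0.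
  by move=> nontriv; rewrite (positive_star h_ge0) /= ntrace_rho_nontrivial // rmorph0.
split=> [erg alpha nontriv | small a].
  have ltd : (0 < \dim {:kappa alpha})%N by case: (irr alpha).
  pose i0 := Ordinal ltd.
  have := erg (star (u alpha i0 i0)); rewrite h0E h_star_rho //.
  move=> /cvgrPdist_lt /(_ 1 ltr01) [N _ /(_ N.+1 (leqnSn N))] /=.
  rewrite conv_pow_rho eqxx mulr1n sub0r normrN normrX => z_lt1.
  have : `|f alpha / (d alpha)%:R| < 1.
    rewrite real_ltNge ?normr_real //; apply: contraTN z_lt1 => z_ge1.
    by rewrite -real_leNgt ?rpredX ?normr_real // exprn_ege1.
  by rewrite normrM normfV normr_nat ltr_pdivrMr ?rep_dim_gt0 // mul1r.
pose cvg_at b := (fun k => conv_pow nu k b : (C : numFieldType)) @ \oo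
              --> (h0 b : (C : numFieldType)).
have cvg0 : cvg_at 0.
  have seq0 : (fun k => conv_pow nu k 0) = (fun=> 0) by apply: funext => k; rewrite linear0.
  by rewrite /cvg_at seq0 linear0; apply: cvg_cst.
have cvgD' x y : cvg_at x -> cvg_at y -> cvg_at (x + y).
  have seqD : (fun k => conv_pow nu k (x + y)) =
      (fun k => conv_pow nu k x + conv_pow nu k y).
    by apply: funext => k; rewrite (linearD (conv_pow nu k)).
  by rewrite /cvg_at seqD (linearD h0); apply: cvgD.
have cvgZ' c x : cvg_at x -> cvg_at (c *: x).
  have seqZ : (fun k => conv_pow nu k (c *: x)) = (fun k => c * conv_pow nu k x).
    by apply: funext => k; rewrite scalarZ.
  rewrite /cvg_at seqZ (scalarZ h0) => cvg_x.
  by apply: cvgM cvg_x; apply: cvg_cst.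
have cvg_rho alpha i j : cvg_at (star (u alpha i j)).
  have seqE : (fun k => conv_pow nu k (star (u alpha i j))) =
      (fun k => (f alpha / (d alpha)%:R) ^+ k.-1.+1 *+ (i == j)).
    by apply: funext => k; rewrite conv_pow_rho.
  rewrite /cvg_at seqE; case: (pselect (trivial_rep (kappa alpha))) => [[d1 u1]|nontriv].
    have val0 (p : 'I_(\dim {:kappa alpha})) : val p = 0%N.
      case: p => p /= ltp; have : (p < d alpha)%N := ltp.
      by rewrite d1 ltnS leqn0 => /eqP.
    have eq_ij : i = j by apply/val_inj; rewrite !val0.
    have z1 : f alpha / (d alpha)%:R = 1.
      by have := central_state_rho i i; rewrite u1 star1 nu1 eqxx mulr1n.
    have seq1 : (fun k => (f alpha / (d alpha)%:R) ^+ k.-1.+1 *+ (i == j)) = (fun=> 1).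
      by apply: funext => k; rewrite eq_ij eqxx z1 expr1n.
    by rewrite seq1 h0E u1 star1 h1; apply: cvg_cst.
  rewrite h0E (h_star_rho _ i j nontriv).
  have [eq_ij|neq_ij] : (i = j) \/ (i != j) by case: (eqVneq i j); [left|right].
    have seqX : (fun k => (f alpha / (d alpha)%:R) ^+ k.-1.+1 *+ (i == j)) =
        (fun k => (f alpha / (d alpha)%:R) ^+ k.-1.+1).
      by apply: funext => k; rewrite eq_ij eqxx.
    rewrite seqX; apply: cvg_exprn.
    rewrite normrM normfV normr_nat ltr_pdivrMr ?rep_dim_gt0 //.
    by rewrite mul1r small.
  have seq0 : (fun k => (f alpha / (d alpha)%:R) ^+ k.-1.+1 *+ (i == j)) = (fun=> 0).
    by apply: funext => k; rewrite (negPf neq_ij).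
  by rewrite seq0; apply: cvg_cst.
exact: (star_rho_ind kappa_irr cvg0 cvgD' cvgZ' cvg_rho).
Qed.

End CentralWalk.
End RandomWalk.

Theorem corollary5p3 (R : realType) (G : finite_quantum_group R)
    (h : {scalar G}) (h_haar : is_haar h)
    (Irr : finType) (kappa : Irr -> unitary_rep G)
    (kappa_irr : complete_irr kappa)
    (nu : {scalar G}) (nu_state : is_state nu)
    (f_nu : G) (f_nu_density : is_density h nu f_nu)
    (f_nu_central : f_nu \in central_algebra kappa)
    (f : Irr -> R[i])
    (f_nuE : f_nu = \sum_(alpha : Irr) f alpha *: character (kappa alpha)) :
  ergodic h nu <->
  (forall alpha : Irr, ~ trivial_rep (kappa alpha) ->
     `|f alpha| < (rep_dim (kappa alpha))%:R).
Proof.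
have hE := haar_ntrace h_haar.
apply: (ergodic_central kappa_irr nu_state.1) => // g.
by rewrite f_nu_density f_nuE hE.
Qed.
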